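(* Let $\mathcal{C}$ be a fusion category, let $Q=(\mathcal{C},V,E,\Pi)$ be a fusion quiver over $\mathcal{C}$, and let $\mathcal{M}$ be a finite semisimple category which is a $(\mathcal{C},\operatorname{Vect})$-bimodule category. Then there is a canonical equivalence of abelian categories $\operatorname{Rep}_{\mathcal{M}}Q\cong\operatorname{Rep}_{\operatorname{Vect}}\check{Q}_{\mathcal{M}}$, where $\check{Q}_{\mathcal{M}}$ is the unfolded quiver of $Q$ with respect to $\mathcal{M}$; explicitly, the functor $F:\operatorname{Rep}_{\mathcal{M}}Q\to\operatorname{Rep}_{\operatorname{Vect}}\check{Q}_{\mathcal{M}}$ defined in the context is such an equivalence.
   Context: $\Bbbk$ is an algebraically closed field; all categories and functors are $\Bbbk$-linear; $\operatorname{Vect}$ is the category of finite-dimensional $\Bbbk$-vector spaces. A fusion category is a semisimple finite abelian rigid monoidal category with simple unit. A left module category over $\mathcal{C}$ is an abelian category $\mathcal{M}$ with an additive monoidal functor $\mathcal{C}\to\operatorname{End}(\mathcal{M})$, written $C\mapsto C\otimes-$. A $(\mathcal{C},\operatorname{Vect})$-bimodule category has in addition a right module structure over $\operatorname{Vect}$ (written $X\boxtimes A$) commuting with the left $\mathcal{C}$-action. $\operatorname{Irr}(\mathcal{M})$ is a set of representatives of isomorphism classes of simple objects. A fusion quiver $Q=(\mathcal{C},V,E,\Pi)$ is a finite quiver $(V,E)$ with source and target maps $s,t$ and an object $\Pi_e\in\mathcal{C}$ on each edge. $\operatorname{Rep}_{\mathcal{M}}Q$: objects $(X,\phi)$ are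 families $X_v\in\mathcal{M}$ ($v\in V$) and morphisms $\phi_e:\Pi_e\otimes X_{s(e)}\to X_{t(e)}$ ($e\in E$); morphisms $f:(X,\phi)\to(Y,\psi)$ are families $f_v:X_v\to Y_v$ with $f_{t(e)}\phi_e=\psi_e(\mathrm{id}_{\Pi_e}\otimes f_{s(e)})$. The unfolded quiver $\check{Q}_{\mathcal{M}}=(\operatorname{Vect},\check V,\check E,\check\Pi)$ is the fusion quiver over $\operatorname{Vect}$ with $\check V=V\times\operatorname{Irr}(\mathcal{M})$; for each $e\in E$ from $s$ to $t$ and each $L,L'\in\operatorname{Irr}(\mathcal{M})$ there is an edge $\check e$ from $(s,L)$ to $(t,L')$ if and only if $L'$ is a direct summand of $\Pi_e\otimes L$, and it is labelled by $\check\Pi_{e,L,L'}=\operatorname{Hom}_{\mathcal{M}}(L',\Pi_e\otimes L)$. The functor $F$: on objects, $(FX)_{(v,L)}=\operatorname{Hom}_{\mathcal{M}}(L,X_v)$, and for the edge $\check e$ from $(s,L)$ to $(t,L')$ over $e$, $F\phi_{\check e}:\operatorname{Hom}(L',\Pi_e\otimes L)\otimes\operatorname{Hom}(L,X_s)\to\operatorname{Hom}(L',X_t)$ sends $\alpha\otimes\beta$ to $\phi_e\circ(\mathrm{id}_{\Pi_e}\otimes\beta)\circ\alpha$. On morphisms, $(Ff)_{(v,L)}(\alpha)=f_v\circ\alpha$. *)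

(* Defs.v *)
From HB Require Import structures.
From mathcomp Require Import all_boot all_algebra.
From mathcomp Require Import boolp.

Set Implicit Arguments.
Unset Strict Implicit.
Unset Printing Implicit Defensive.

Import GRing.Theory.
Local Open Scope ring_scope.

(* The library only gives a vectType structure on non-dependent {ffun I -> V};
   morphisms of representations are families with values in varying spaces. *)
Section DependentProduct.
Variables (K : fieldType) (I : finType) (T : I -> vectType K).

Definition dprod : Type := {dffun forall i : I, T i}.
HB.instance Definition _ := Choice.copy dprod {dffun forall i : I, T i}.

Definition dprod_of (f : forall i, T i) : dprod := finfun f.
Definition dapp (f : dprod) (i : I) : T i := (f : {dffun forall i : I, T i}) i.

Lemma dprod_ofE f i : dapp (dprod_of f) i = f i.
Proof. by rewrite /dapp ffunE. Qed.

Lemma dprodP (f g : dprod) : (forall i, dapp f i = dapp g i) <-> f = g.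
Proof. by split=> [e | -> //]; apply/ffunP. Qed.

Definition dprod_add f g := dprod_of (fun i => dapp f i + dapp g i).
Definition dprod_opp f := dprod_of (fun i => - dapp f i).
Definition dprod_scale (a : K) f := dprod_of (fun i => a *: dapp f i).

Fact dprod_addA : associative dprod_add.
Proof. by move=> f g h; apply/dprodP=> i; rewrite !dprod_ofE addrA. Qed.
Fact dprod_addC : commutative dprod_add.
Proof. by move=> f g; apply/dprodP=> i; rewrite !dprod_ofE addrC. Qed.
Fact dprod_add0 : left_id (dprod_of (fun=> 0)) dprod_add.
Proof. by move=> f; apply/dprodP=> i; rewrite !dprod_ofE add0r. Qed.
Fact dprod_addN : left_inverse (dprod_of (fun=> 0)) dprod_opp dprod_add.
Proof. by move=> f; apply/dprodP=> i; rewrite !dprod_ofE addNr. Qed.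

HB.instance Definition _ :=
  GRing.isZmodule.Build dprod dprod_addA dprod_addC dprod_add0 dprod_addN.

Lemma dprod_addE (f g : dprod) i : dapp (f + g) i = dapp f i + dapp g i.
Proof. exact: dprod_ofE. Qed.

Fact dprod_scaleA a b f :
  dprod_scale a (dprod_scale b f) = dprod_scale (a * b) f.
Proof. by apply/dprodP=> i; rewrite !dprod_ofE scalerA. Qed.
Fact dprod_scale1 : left_id 1 dprod_scale.
Proof. by move=> f; apply/dprodP=> i; rewrite !dprod_ofE scale1r. Qed.
Fact dprod_scaleDr : right_distributive dprod_scale +%R.
Proof.
by move=> a f g; apply/dprodP=> i; rewrite !(dprod_ofE, dprod_addE) scalerDr.
Qed.
Fact dprod_scaleDl f : {morph dprod_scale^~ f : a b / a + b}.
Proof.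
by move=> a b; apply/dprodP=> i; rewrite !(dprod_ofE, dprod_addE) scalerDl.
Qed.

HB.instance Definition _ := GRing.Zmodule_isLmodule.Build K dprod
  dprod_scaleA dprod_scale1 dprod_scaleDr dprod_scaleDl.

Lemma dprod_scaleE a (f : dprod) i : dapp (a *: f) i = a *: dapp f i.
Proof. exact: dprod_ofE. Qed.

Lemma dapp_linear i : linear (dapp^~ i).
Proof. by move=> a f g; rewrite dprod_addE dprod_scaleE. Qed.

Import VectorInternalTheory.

Let p (j : 'I_#|I|) := dim (T (enum_val j)).
Let to_row (f : dprod) : 'rV[K]_(\sum_j p j) :=
  \mxrow_j (v2r (dapp f (enum_val j)) : 'rV_(p j)).
Let blk (r : 'rV[K]_(\sum_j p j)) j : T (enum_val j) :=
  @r2v K (T (enum_val j)) (submxrow r j).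
Let of_row (r : 'rV[K]_(\sum_j p j)) : dprod :=
  dprod_of (fun i => ecast i (T i) (enum_rankK i) (blk r (enum_rank i))).

Fact dprod_vect_iso : Vector.axiom (\sum_j p j) dprod.
Proof.
exists to_row.
  move=> a f g; apply/rowP=> k.
  by rewrite !mxE dapp_linear linearP !mxE.
exists of_row => [f | r].
  apply/dprodP=> i; rewrite dprod_ofE.
  rewrite /blk mxrowK v2rK.
  by move: (enum_rankK i); move: (enum_val _) => k e; case: i / e.
apply/mxrowP=> j; rewrite mxrowK dprod_ofE.
suff E j' (e : enum_val j' = enum_val j) :
    ecast i (T i) e (blk r j') = blk r j by rewrite E /blk r2vK.
have ej := enum_val_inj e; subst j'.
by rewrite eq_axiomK.
Qed.
HB.instance Definition _ := Lmodule_hasFinDim.Build K dprod dprod_vect_iso.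

End DependentProduct.

(* A k-linear category with finite-dimensional Hom-spaces. *)
Record linCat (K : fieldType) := LinCat {
  obj :> Type;
  mor : obj -> obj -> vectType K;
  idm : forall X, mor X X;
  mcomp : forall X Y Z, mor Y Z -> mor X Y -> mor X Z;
  mcompA : forall X Y Z W (h : mor Z W) (g : mor Y Z) (f : mor X Y),
    mcomp h (mcomp g f) = mcomp (mcomp h g) f;
  mcomp1m : forall X Y (f : mor X Y), mcomp (idm Y) f = f;
  mcompm1 : forall X Y (f : mor X Y), mcomp f (idm X) = f;
  mcomp_linl : forall X Y Z (f : mor X Y), linear (fun g : mor Y Z => mcomp g f);
  mcomp_linr : forall X Y Z (g : mor Y Z), linear (fun f : mor X Y => mcomp g f)
}.
Arguments mor {K l} X Y : rename.
Arguments idm {K l} X : rename.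
Arguments mcomp {K l X Y Z} g f : rename.

Declare Scope cat_scope.
Delimit Scope cat_scope with cat.
Local Open Scope cat_scope.
Notation "g \oc f" := (mcomp g f) (at level 40, left associativity) : cat_scope.

Section CategoricalNotions.
Variables (K : fieldType) (A : linCat K).
Implicit Types X Y Z : A.

Definition is_iso X Y (f : mor X Y) :=
  exists g : mor Y X, g \oc f = idm X /\ f \oc g = idm Y.

Record iso X Y := Iso {
  iso_mor :> mor X Y;
  iso_inv : mor Y X;
  iso_invK : iso_inv \oc iso_mor = idm X;
  iso_morK : iso_mor \oc iso_inv = idm Y
}.

Definition is_mono X Y (f : mor X Y) :=
  forall T (g h : mor T X), f \oc g = f \oc h -> g = h.

Definition is_epi X Y (f : mor X Y) :=
  forall T (g h : mor Y T), g \oc f = h \oc f -> g = h.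

Definition is_zero X :=
  forall Y, (forall f : mor X Y, f = 0) /\ (forall f : mor Y X, f = 0).

Definition is_kernel X Y N (f : mor X Y) (k : mor N X) :=
  f \oc k = 0 /\
  forall T (h : mor T X), f \oc h = 0 -> exists! u : mor T N, k \oc u = h.

Definition is_cokernel X Y N (f : mor X Y) (c : mor Y N) :=
  c \oc f = 0 /\
  forall T (h : mor Y T), h \oc f = 0 -> exists! u : mor N T, u \oc c = h.

(* S, with the injections i and the projections p, is the direct sum of the
   finite family X. *)
Definition is_direct_sum (J : finType) (X : J -> A) (S : A)
    (i : forall j, mor (X j) S) (p : forall j, mor S (X j)) :=
  [/\ forall j, p j \oc i j = idm (X j),
      forall j l, j <> l -> p l \oc i j = 0
    & \sum_j i j \oc p j = idm S].

Definition is_biproduct X Y S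
    (iX : mor X S) (iY : mor Y S) (pX : mor S X) (pY : mor S Y) :=
  [/\ pX \oc iX = idm X, pY \oc iY = idm Y, pX \oc iY = 0, pY \oc iX = 0
    & iX \oc pX + iY \oc pY = idm S].

Record is_abelian : Prop := IsAbelian {
  abelian_zero : exists Z, is_zero Z;
  abelian_biproduct : forall X Y, exists S (iX : mor X S) (iY : mor Y S)
    (pX : mor S X) (pY : mor S Y), is_biproduct iX iY pX pY;
  abelian_kernel : forall X Y (f : mor X Y),
    exists N (k : mor N X), is_kernel f k;
  abelian_cokernel : forall X Y (f : mor X Y),
    exists N (c : mor Y N), is_cokernel f c;
  abelian_mono : forall X Y (f : mor X Y), is_mono f ->
    exists Z (g : mor Y Z), is_kernel g f;
  abelian_epi : forall X Y (f : mor X Y), is_epi f ->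
    exists Z (g : mor Z X), is_cokernel g f
}.

Definition is_simple X :=
  ~ is_zero X /\ forall Y (i : mor Y X), is_mono i -> is_zero Y \/ is_iso i.

Definition direct_summand X S := exists Y (iX : mor X S) (iY : mor Y S)
  (pX : mor S X) (pY : mor S Y), is_biproduct iX iY pX pY.

Definition is_semisimple := forall S, exists (n : nat) (X : 'I_n -> A)
  (i : forall j, mor (X j) S) (p : forall j, mor S (X j)),
  (forall j, is_simple (X j)) /\ is_direct_sum i p.

Inductive finite_length : A -> Prop :=
| finite_length_zero X : is_zero X -> finite_length X
| finite_length_ext X Y S (i : mor Y X) (p : mor X S) :
    is_kernel p i -> is_cokernel i p -> is_simple S ->
    finite_length Y -> finite_length X.

Definition projective P := forall X Y (e : mor X Y) (f : mor P Y),
  is_epi e -> exists g : mor P X, e \oc g = f.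

(* Finiteness of an abelian category; finite-dimensionality of the
   Hom-spaces is part of linCat. *)
Record is_finite : Prop := IsFinite {
  finite_finite_length : forall X, finite_length X;
  finite_enough_projectives : forall X, exists P (e : mor P X),
    projective P /\ is_epi e;
  finite_simples : exists (n : nat) (L : 'I_n -> A),
    forall X, is_simple X -> exists j (f : mor (L j) X), is_iso f
}.

(* Representatives of the isomorphism classes of simple objects. *)
Record irr := Irr {
  irr_index : finType;
  irr_obj :> irr_index -> A;
  irr_simple : forall j, is_simple (irr_obj j);
  irr_inj : forall j l (f : mor (irr_obj j) (irr_obj l)), is_iso f -> j = l;
  irr_surj : forall X, is_simple X ->
    exists j (f : mor (irr_obj j) X), is_iso f
}.

End CategoricalNotions.
Arguments is_abelian {K} A.
Arguments is_semisimple {K} A.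
Arguments is_finite {K} A.
Arguments irr {K} A.
Arguments iso_inv {K A X Y} i : rename.

Record linFunctor (K : fieldType) (A B : linCat K) := LinFunctor {
  fobj :> A -> B;
  fmor : forall X Y : A, mor X Y -> mor (fobj X) (fobj Y);
  fmor_lin : forall X Y : A, linear (@fmor X Y);
  fmor1 : forall X : A, fmor (idm X) = idm (fobj X);
  fmorM : forall (X Y Z : A) (g : mor Y Z) (f : mor X Y),
    fmor (g \oc f) = fmor g \oc fmor f
}.
Arguments fmor {K A B} F [X Y] f : rename.

Section Equivalences.
Variables (K : fieldType) (A B : linCat K).

(* An equivalence of abelian categories is a linear equivalence: exactness is
   then automatic. *)
Definition is_equivalence (F : linFunctor A B) :=
  exists (G : linFunctor B A) (eta : forall X : A, iso X (G (F X)))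
         (eps : forall Y : B, iso (F (G Y)) Y),
    (forall (X X' : A) (f : mor X X'),
       eta X' \oc f = fmor G (fmor F f) \oc eta X) /\
    (forall (Y Y' : B) (f : mor Y Y'),
       eps Y' \oc fmor F (fmor G f) = f \oc eps Y).

End Equivalences.

Record bifunctor (K : fieldType) (A B D : linCat K) := Bifunctor {
  bobj :> A -> B -> D;
  bmor : forall (X X' : A) (Y Y' : B),
    mor X X' -> mor Y Y' -> mor (bobj X Y) (bobj X' Y');
  bmor_linl : forall (X X' : A) (Y Y' : B) (g : mor Y Y'),
    linear (fun f : mor X X' => bmor f g);
  bmor_linr : forall (X X' : A) (Y Y' : B) (f : mor X X'),
    linear (fun g : mor Y Y' => bmor f g);
  bmor1 : forall (X : A) (Y : B), bmor (idm X) (idm Y) = idm (bobj X Y);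
  bmorM : forall (X X' X'' : A) (Y Y' Y'' : B)
    (f' : mor X' X'') (f : mor X X') (g' : mor Y' Y'') (g : mor Y Y'),
    bmor (f' \oc f) (g' \oc g) = bmor f' g' \oc bmor f g
}.
Arguments bmor {K A B D} b [X X' Y Y'] f g : rename.

Record monCat (K : fieldType) := MonCat {
  mon_cat :> linCat K;
  ten : bifunctor mon_cat mon_cat mon_cat;
  unit_obj : mon_cat;
  massoc : forall X Y Z, iso (ten (ten X Y) Z) (ten X (ten Y Z));
  munitl : forall X, iso (ten unit_obj X) X;
  munitr : forall X, iso (ten X unit_obj) X;
  massoc_nat : forall X X' Y Y' Z Z'
    (f : mor X X') (g : mor Y Y') (h : mor Z Z'),
    massoc X' Y' Z' \oc bmor ten (bmor ten f g) h =
    bmor ten f (bmor ten g h) \oc massoc X Y Z;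
  munitl_nat : forall X X' (f : mor X X'),
    munitl X' \oc bmor ten (idm unit_obj) f = f \oc munitl X;
  munitr_nat : forall X X' (f : mor X X'),
    munitr X' \oc bmor ten f (idm unit_obj) = f \oc munitr X;
  mpentagon : forall X Y Z W,
    bmor ten (idm X) (massoc Y Z W) \oc massoc X (ten Y Z) W
      \oc bmor ten (massoc X Y Z) (idm W) =
    massoc X Y (ten Z W) \oc massoc (ten X Y) Z W;
  mtriangle : forall X Y,
    bmor ten (idm X) (munitl Y) \oc massoc X unit_obj Y =
    bmor ten (munitr X) (idm Y)
}.
Arguments ten {K} C : rename.
Arguments unit_obj {K} C : rename.
Arguments massoc {K C} X Y Z : rename.
Arguments munitl {K C} X : rename.
Arguments munitr {K C} X : rename.

Section Fusion.
Variables (K : fieldType) (C : monCat K).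

(* Y is a left dual of X (equivalently, X is a right dual of Y). *)
Definition is_dual (Y X : C) :=
  exists (ev : mor (ten C Y X) (unit_obj C))
         (coev : mor (unit_obj C) (ten C X Y)),
    munitr X \oc bmor (ten C) (idm X) ev \oc massoc X Y X
      \oc bmor (ten C) coev (idm X) = munitl X /\
    munitl Y \oc bmor (ten C) ev (idm Y) \oc iso_inv (massoc Y X Y)
      \oc bmor (ten C) (idm Y) coev = munitr Y.

Definition is_rigid := forall X : C,
  (exists Y, is_dual Y X) /\ (exists Y, is_dual X Y).

Record is_fusion : Prop := IsFusion {
  fusion_abelian : is_abelian C;
  fusion_finite : is_finite C;
  fusion_semisimple : is_semisimple C;
  fusion_rigid : is_rigid;
  fusion_unit : is_simple (unit_obj C)
}.

End Fusion.

Record fusionCat (K : fieldType) := FusionCat {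
  fusion_mon :> monCat K;
  fusionP : is_fusion fusion_mon
}.

(* A left module category: an abelian category with a linear monoidal functor
   C -> End(M), spelled out.  lm_assoc and lm_unit are the monoidal structure
   of that functor; the last three fields are its coherence axioms. *)
Record leftModule (K : fieldType) (C : monCat K) := LeftModule {
  lm_cat :> linCat K;
  lm_abelian : is_abelian lm_cat;
  act : bifunctor C lm_cat lm_cat;
  lm_assoc : forall (A B : C) (X : lm_cat),
    iso (act (ten C A B) X) (act A (act B X));
  lm_unit : forall X : lm_cat, iso (act (unit_obj C) X) X;
  lm_assoc_nat : forall (A A' B B' : C) (X X' : lm_cat)
    (f : mor A A') (g : mor B B') (h : mor X X'),
    lm_assoc A' B' X' \oc bmor act (bmor (ten C) f g) h =
    bmor act f (bmor act g h) \oc lm_assoc A B X;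
  lm_unit_nat : forall (X X' : lm_cat) (h : mor X X'),
    lm_unit X' \oc bmor act (idm (unit_obj C)) h = h \oc lm_unit X;
  lm_pentagon : forall (A B D : C) (X : lm_cat),
    bmor act (idm A) (lm_assoc B D X) \oc lm_assoc A (ten C B D) X
      \oc bmor act (massoc A B D) (idm X) =
    lm_assoc A B (act D X) \oc lm_assoc (ten C A B) D X;
  lm_unitl : forall (A : C) (X : lm_cat),
    lm_unit (act A X) \oc lm_assoc (unit_obj C) A X =
    bmor act (munitl A) (idm X);
  lm_unitr : forall (A : C) (X : lm_cat),
    bmor act (idm A) (lm_unit X) \oc lm_assoc A (unit_obj C) X =
    bmor act (munitr A) (idm X)
}.
Arguments act {K C} M : rename.
Arguments lm_assoc {K C M} A B X : rename.

Record bimodule (K : fieldType) (C D : monCat K) := Bimodule {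
  bm_left :> leftModule C;
  ract : bifunctor bm_left D bm_left;
  rm_assoc : forall (X : bm_left) (A B : D),
    iso (ract X (ten D A B)) (ract (ract X A) B);
  rm_unit : forall X : bm_left, iso (ract X (unit_obj D)) X;
  rm_assoc_nat : forall (X X' : bm_left) (A A' B B' : D)
    (h : mor X X') (f : mor A A') (g : mor B B'),
    rm_assoc X' A' B' \oc bmor ract h (bmor (ten D) f g) =
    bmor ract (bmor ract h f) g \oc rm_assoc X A B;
  rm_unit_nat : forall (X X' : bm_left) (h : mor X X'),
    rm_unit X' \oc bmor ract h (idm (unit_obj D)) = h \oc rm_unit X;
  rm_pentagon : forall (X : bm_left) (A B E : D),
    bmor ract (rm_assoc X A B) (idm E) \oc rm_assoc X (ten D A B) E =
    rm_assoc (ract X A) B E \oc rm_assoc X A (ten D B E)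
      \oc bmor ract (idm X) (massoc A B E);
  rm_unitl : forall (X : bm_left) (A : D),
    bmor ract (rm_unit X) (idm A) \oc rm_assoc X (unit_obj D) A =
    bmor ract (idm X) (munitl A);
  rm_unitr : forall (X : bm_left) (A : D),
    rm_unit (ract X A) \oc rm_assoc X A (unit_obj D) =
    bmor ract (idm X) (munitr A);
  (* The two actions commute, up to a coherent isomorphism. *)
  bm_mid : forall (A : C) (X : bm_left) (B : D),
    iso (ract (act bm_left A X) B) (act bm_left A (ract X B));
  bm_mid_nat : forall (A A' : C) (X X' : bm_left) (B B' : D)
    (f : mor A A') (h : mor X X') (g : mor B B'),
    bm_mid A' X' B' \oc bmor ract (bmor (act bm_left) f h) g =
    bmor (act bm_left) f (bmor ract h g) \oc bm_mid A X B;
  bm_pentagonl : forall (A A' : C) (X : bm_left) (B : D),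
    bmor (act bm_left) (idm A) (bm_mid A' X B) \oc bm_mid A (act bm_left A' X) B
      \oc bmor ract (lm_assoc A A' X) (idm B) =
    lm_assoc A A' (ract X B) \oc bm_mid (ten C A A') X B;
  bm_pentagonr : forall (A : C) (X : bm_left) (B B' : D),
    bmor (act bm_left) (idm A) (rm_assoc X B B') \oc bm_mid A X (ten D B B') =
    bm_mid A (ract X B) B' \oc bmor ract (bm_mid A X B) (idm B')
      \oc rm_assoc (act bm_left A X) B B'
}.

(* The tensor product of U and V is realised as Hom(U^*, V), the pure tensor of
   u and v being the map f |-> f(u) v; tliftE and tens_ext give its universal
   property. *)
Section TensorProduct.
Variable K : fieldType.
Implicit Types U V W T : vectType K.

Lemma lfunE_lin U V (f : U -> V) : linear f -> linfun f =1 f.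
Proof.
move=> lin; pose F := GRing.isLinear.Build _ _ _ _ _ lin.
pose G : {linear U -> V} := HB.pack f F.
by move=> x; rewrite -[f]/(G : _ -> _) lfunE.
Qed.

Lemma linear_scale U V (f : U -> V) : linear f -> forall a u, f (a *: u) = a *: f u.
Proof. by move=> lin a u; rewrite -(lfunE_lin lin) linearZ /= lfunE_lin. Qed.

Lemma linear_sumE U V (f : U -> V) : linear f ->
  forall (I : finType) (x : I -> U), f (\sum_i x i) = \sum_i f (x i).
Proof.
move=> lin I x; rewrite -(lfunE_lin lin) linear_sum.
by apply: eq_bigr => i _; rewrite /= lfunE_lin.
Qed.

Lemma lin_sum U V (f : U -> V) : linear f ->
  forall (I : finType) (a : I -> K) (x : I -> U),
  f (\sum_i a i *: x i) = \sum_i a i *: f (x i).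
Proof.
move=> lin I a x; rewrite -(lfunE_lin lin) linear_sum.
by apply: eq_bigr => i _; rewrite linearZ /= lfunE_lin.
Qed.

Definition vdual U : vectType K := 'Hom(U, K^o).
Definition tens U V : vectType K := 'Hom(vdual U, V).

Definition pure U V (u : U) (v : V) : tens U V :=
  linfun (fun f : vdual U => (f u : K) *: v).

Lemma pureE U V (u : U) (v : V) (f : vdual U) : pure u v f = (f u : K) *: v.
Proof.
rewrite /pure lfunE_lin // => a g h.
by rewrite add_lfunE scale_lfunE scalerDl scalerA.
Qed.

Lemma pure_linl U V (v : V) : linear (fun u : U => pure u v).
Proof.
move=> a u u'; apply/lfunP=> f.
by rewrite add_lfunE scale_lfunE !pureE linearP scalerDl scalerA.
Qed.

Lemma pure_linr U V (u : U) : linear (fun v : V => pure u v).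
Proof.
move=> a v v'; apply/lfunP=> f.
rewrite add_lfunE scale_lfunE !pureE scalerDr !scalerA; congr (_ *: _ + _).
exact: mulrC.
Qed.

Definition ebas U (i : 'I_(\dim {:U})) : U := (vbasis {:U})`_i.
Definition ecoord U (i : 'I_(\dim {:U})) : vdual U :=
  linfun (coord (vbasis {:U}) i : U -> K^o).

Lemma ebas_sum U (u : U) : u = \sum_i (ecoord i u : K) *: ebas i.
Proof.
rewrite {1}(coord_vbasis (memvf u)); apply: eq_bigr => i _.
by rewrite /ecoord lfunE_lin //; apply: linearP.
Qed.

Lemma ecoord_sum U (f : vdual U) : f = \sum_i (f (ebas i) : K) *: ecoord i.
Proof.
apply/lfunP=> u; rewrite sum_lfunE {1}(ebas_sum u) linear_sum.
apply: eq_bigr => i _; rewrite linearZ scale_lfunE.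
exact: mulrC.
Qed.

Lemma pure_sum U V (t : tens U V) : t = \sum_i pure (ebas i) (t (ecoord i)).
Proof.
apply/lfunP=> f; rewrite sum_lfunE {1}(ecoord_sum f) linear_sum.
by apply: eq_bigr => i _; rewrite linearZ pureE.
Qed.

Lemma tens_ext U V W (f g : 'Hom(tens U V, W)) :
  (forall u v, f (pure u v) = g (pure u v)) -> f = g.
Proof.
move=> e; apply/lfunP=> t; rewrite (pure_sum t) !linear_sum.
by apply: eq_bigr => i _; apply: e.
Qed.

(* Meaningful only when b is bilinear. *)
Definition tlift U V W (b : U -> V -> W) : 'Hom(tens U V, W) :=
  linfun (fun t : tens U V => \sum_i b (ebas i) (t (ecoord i))).

Definition bilinear2 U V W (b : U -> V -> W) :=
  (forall v, linear (b^~ v)) /\ (forall u, linear (b u)).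

Lemma tliftE U V W (b : U -> V -> W) : bilinear2 b ->
  forall u v, tlift b (pure u v) = b u v.
Proof.
move=> [bl br] u v; rewrite /tlift lfunE_lin.
  rewrite {2}(ebas_sum u) (lin_sum (bl v)).
  apply: eq_bigr => i _; rewrite pureE.
  by rewrite (linear_scale (br _)).
move=> a s t; rewrite scaler_sumr -big_split; apply: eq_bigr => i _.
by rewrite add_lfunE scale_lfunE br.
Qed.

Definition tmap U U' V V' (f : 'Hom(U, U')) (g : 'Hom(V, V')) :
  'Hom(tens U V, tens U' V') := tlift (fun u v => pure (f u) (g v)).

Lemma tmapE U U' V V' (f : 'Hom(U, U')) (g : 'Hom(V, V')) u v :
  tmap f g (pure u v) = pure (f u) (g v).
Proof.
apply: (tliftE (b := fun u v => pure (f u) (g v))); split=> [w | w] a x y.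
  by rewrite linearP pure_linl.
by rewrite linearP pure_linr.
Qed.

Lemma pure_sclr U V a (u : U) (v : V) : pure u (a *: v) = a *: pure u v.
Proof. exact: (linear_scale (pure_linr u)). Qed.
Lemma pure_scll U V a (u : U) (v : V) : pure (a *: u) v = a *: pure u v.
Proof. exact: (linear_scale (pure_linl v)). Qed.

Lemma pure_suml U V (I : finType) (x : I -> U) (v : V) :
  pure (\sum_i x i) v = \sum_i pure (x i) v.
Proof. exact: (linear_sumE (pure_linl v)). Qed.
Lemma pure_sumr U V (I : finType) (u : U) (x : I -> V) :
  pure u (\sum_i x i) = \sum_i pure u (x i).
Proof. exact: (linear_sumE (pure_linr u)). Qed.

Lemma tlift_lin U V W T (b : T -> U -> V -> W) :
  (forall t, bilinear2 (b t)) -> (forall u v, linear (fun t => b t u v)) ->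
  linear (fun t => tlift (b t)).
Proof.
move=> bb bt a t t'; apply: tens_ext => u v.
by rewrite add_lfunE scale_lfunE !tliftE ?bt.
Qed.

Lemma tens_ext3l U V W T (f g : 'Hom(tens (tens U V) W, T)) :
  (forall u v w, f (pure (pure u v) w) = g (pure (pure u v) w)) -> f = g.
Proof.
move=> e; apply: tens_ext => t w.
have E : (f \o linfun (fun t => pure t w))%VF = (g \o linfun (fun t => pure t w))%VF.
  by apply: tens_ext => u v; rewrite !comp_lfunE !lfunE_lin //; apply: pure_linl.
move/lfunP/(_ t): E; rewrite !comp_lfunE !lfunE_lin //; exact: pure_linl.
Qed.

Lemma tens_ext3r U V W T (f g : 'Hom(tens U (tens V W), T)) :
  (forall u v w, f (pure u (pure v w)) = g (pure u (pure v w))) -> f = g.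
Proof.
move=> e; apply: tens_ext => u t.
have E : (f \o linfun (fun t => pure u t))%VF = (g \o linfun (fun t => pure u t))%VF.
  by apply: tens_ext => v w; rewrite !comp_lfunE !lfunE_lin //; apply: pure_linr.
move/lfunP/(_ t): E; rewrite !comp_lfunE !lfunE_lin //; exact: pure_linr.
Qed.

Lemma tens_ext4 U V W X T (f g : 'Hom(tens (tens (tens U V) W) X, T)) :
  (forall u v w x, f (pure (pure (pure u v) w) x) = g (pure (pure (pure u v) w) x)) ->
  f = g.
Proof.
move=> e; apply: tens_ext => t x.
have E : (f \o linfun (fun t => pure t x))%VF = (g \o linfun (fun t => pure t x))%VF.
  by apply: tens_ext3l => u v w; rewrite !comp_lfunE !lfunE_lin //; apply: pure_linl.
move/lfunP/(_ t): E; rewrite !comp_lfunE !lfunE_lin //; exact: pure_linl.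
Qed.

Definition tassoc U V W : 'Hom(tens (tens U V) W, tens U (tens V W)) :=
  tlift (fun t w => tlift (fun u v => pure u (pure v w)) t).
Definition tassocV U V W : 'Hom(tens U (tens V W), tens (tens U V) W) :=
  tlift (fun u t => tlift (fun v w => pure (pure u v) w) t).
Definition tunitl V : 'Hom(tens K^o V, V) := tlift (fun (a : K^o) v => (a : K) *: v).
Definition tunitr V : 'Hom(tens V K^o, V) := tlift (fun v (a : K^o) => (a : K) *: v).

Lemma tassocE U V W (u : U) (v : V) (w : W) :
  tassoc U V W (pure (pure u v) w) = pure u (pure v w).
Proof.
have b1 (w' : W) : bilinear2 (fun (u : U) (v : V) => pure u (pure v w')).
  by split=> x a y z; rewrite ?pure_linl ?pure_linr.
have b2 : bilinear2 (fun (t : tens U V) (w : W) => tlift (fun (u : U) (v : V) => pure u (pure v w)) t).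
  split=> [w' | s] a x y; first by rewrite linearP.
  rewrite (tlift_lin (b := fun (w : W) (u : U) (v : V) => pure u (pure v w))) //.
    by rewrite add_lfunE scale_lfunE.
  by move=> u' v' a' x' y'; rewrite !pure_linr.
by rewrite /tassoc (tliftE b2) (tliftE (b1 w)).
Qed.

Lemma tassocVE U V W (u : U) (v : V) (w : W) :
  tassocV U V W (pure u (pure v w)) = pure (pure u v) w.
Proof.
have b1 (u' : U) : bilinear2 (fun (v : V) (w : W) => pure (pure u' v) w).
  by split=> x a y z; rewrite ?pure_linr ?pure_linl.
have b2 : bilinear2 (fun (u : U) (t : tens V W) => tlift (fun (v : V) (w : W) => pure (pure u v) w) t).
  split=> [s | u'] a x y; last by rewrite linearP.
  rewrite (tlift_lin (b := fun (u : U) (v : V) (w : W) => pure (pure u v) w)) //.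
    by rewrite add_lfunE scale_lfunE.
  by move=> u' v' a' x' y'; rewrite !pure_linl.
by rewrite /tassocV (tliftE b2) (tliftE (b1 u)).
Qed.

Lemma tunitlE V (a : K^o) (v : V) : tunitl V (pure a v) = (a : K) *: v.
Proof.
rewrite /tunitl (tliftE (b := fun (a : K^o) v => (a : K) *: v)) //.
split=> [w | c] k x y; first by rewrite scalerDl scalerA.
by rewrite scalerDr !scalerA mulrC.
Qed.

Lemma tunitrE V (v : V) (a : K^o) : tunitr V (pure v a) = (a : K) *: v.
Proof.
rewrite /tunitr (tliftE (b := fun v (a : K^o) => (a : K) *: v)) //.
split=> [c | w] k x y; last by rewrite scalerDl scalerA.
by rewrite scalerDr !scalerA mulrC.
Qed.

Fact tassoc_K U V W : (tassocV U V W \o tassoc U V W)%VF = \1%VF.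
Proof.
by apply: tens_ext3l => u v w; rewrite comp_lfunE tassocE tassocVE id_lfunE.
Qed.
Fact tassocV_K U V W : (tassoc U V W \o tassocV U V W)%VF = \1%VF.
Proof.
by apply: tens_ext3r => u v w; rewrite comp_lfunE tassocVE tassocE id_lfunE.
Qed.
Fact tunitl_K V : (linfun (pure (1 : K^o)) \o tunitl V)%VF = \1%VF.
Proof.
apply: tens_ext => a v; rewrite comp_lfunE tunitlE id_lfunE.
rewrite (lfunE_lin (pure_linr (1 : K^o))).
by rewrite pure_sclr -pure_scll; congr pure; apply: mulr1.
Qed.
Fact tunitlV_K V : (tunitl V \o linfun (pure (1 : K^o)))%VF = \1%VF.
Proof.
apply/lfunP=> v; rewrite comp_lfunE id_lfunE.
rewrite (lfunE_lin (pure_linr (1 : K^o))).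
by rewrite tunitlE scale1r.
Qed.
Fact tunitr_K V : (linfun (fun v => pure v (1 : K^o)) \o tunitr V)%VF = \1%VF.
Proof.
apply: tens_ext => v a; rewrite comp_lfunE tunitrE id_lfunE.
rewrite (lfunE_lin (pure_linl (1 : K^o))).
by rewrite pure_scll -pure_sclr; congr pure; apply: mulr1.
Qed.
Fact tunitrV_K V : (tunitr V \o linfun (fun v => pure v (1 : K^o)))%VF = \1%VF.
Proof.
apply/lfunP=> v; rewrite comp_lfunE id_lfunE.
rewrite (lfunE_lin (pure_linl (1 : K^o))).
by rewrite tunitrE scale1r.
Qed.

Definition tensE := (comp_lfunE, tmapE, tassocE, tassocVE, tunitlE, tunitrE, id_lfunE).

End TensorProduct.

Section Vect.
Variable K : fieldType.

Fact vect_comp_linl (U V W : vectType K) (f : 'Hom(U, V)) :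
  linear (fun g : 'Hom(V, W) => (g \o f)%VF).
Proof. by move=> a g h; rewrite comp_lfunDl -comp_lfunZl. Qed.

Fact vect_comp_linr (U V W : vectType K) (g : 'Hom(V, W)) :
  linear (fun f : 'Hom(U, V) => (g \o f)%VF).
Proof. by move=> a f h; rewrite comp_lfunDr -comp_lfunZr. Qed.

Definition VectCat : linCat K := {|
  obj := vectType K;
  mor := fun U V => 'Hom(U, V);
  idm := fun U => \1%VF;
  mcomp := fun U V W g f => (g \o f)%VF;
  mcompA := fun U V W X h g f => comp_lfunA h g f;
  mcomp1m := fun U V f => comp_lfun1l f;
  mcompm1 := fun U V f => comp_lfun1r f;
  mcomp_linl := vect_comp_linl;
  mcomp_linr := vect_comp_linr
|}.

Fact tmap_linl (U U' V V' : vectType K) (g : 'Hom(V, V')) :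
  linear (fun f : 'Hom(U, U') => tmap f g).
Proof.
move=> a f f'; apply: tens_ext => u v.
by rewrite add_lfunE scale_lfunE !tmapE add_lfunE scale_lfunE pure_linl.
Qed.
Fact tmap_linr (U U' V V' : vectType K) (f : 'Hom(U, U')) :
  linear (fun g : 'Hom(V, V') => tmap f g).
Proof.
move=> a g g'; apply: tens_ext => u v.
by rewrite add_lfunE scale_lfunE !tmapE add_lfunE scale_lfunE pure_linr.
Qed.
Fact tmap1 (U V : vectType K) : tmap \1 \1 = \1%VF :> 'End(tens U V).
Proof. by apply: tens_ext => u v; rewrite !tensE. Qed.
Fact tmapM (U U' U'' V V' V'' : vectType K)
    (f' : 'Hom(U', U'')) (f : 'Hom(U, U'))
    (g' : 'Hom(V', V'')) (g : 'Hom(V, V')) :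
  tmap (f' \o f) (g' \o g) = (tmap f' g' \o tmap f g)%VF.
Proof. by apply: tens_ext => u v; rewrite !tensE. Qed.

Definition vect_ten : bifunctor VectCat VectCat VectCat :=
  @Bifunctor K VectCat VectCat VectCat (@tens K) (@tmap K)
    tmap_linl tmap_linr tmap1 tmapM.

Definition vect_assoc (U V W : VectCat) :
    @iso K VectCat (tens (tens U V) W) (tens U (tens V W)) :=
  @Iso K VectCat _ _ (tassoc U V W) (tassocV U V W)
    (tassoc_K U V W) (tassocV_K U V W).
Definition vect_unitl (V : VectCat) : @iso K VectCat (tens K^o V) V :=
  @Iso K VectCat _ _ (tunitl V) _ (tunitl_K V) (tunitlV_K V).
Definition vect_unitr (V : VectCat) : @iso K VectCat (tens V K^o) V :=
  @Iso K VectCat _ _ (tunitr V) _ (tunitr_K V) (tunitrV_K V).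

Definition VectMon : monCat K.
Proof.
refine (@MonCat K VectCat vect_ten (K^o : vectType K)
  vect_assoc vect_unitl vect_unitr _ _ _ _ _) => /=.
- by move=> *; apply: tens_ext3l => u v w; rewrite !tensE.
- by move=> *; apply: tens_ext => a v; rewrite !tensE linearZ.
- by move=> *; apply: tens_ext => v a; rewrite !tensE linearZ.
- by move=> *; apply: tens_ext4 => u v w x; rewrite !tensE.
- move=> *; apply: tens_ext3l => u a v; rewrite !tensE.
  by rewrite pure_sclr pure_scll.
Defined.

Lemma vect_monoP (U V : vectType K) (f : 'Hom(U, V)) :
  @is_mono K VectCat U V f -> lker f == 0%VS.
Proof.
move=> mf; have /lfunP e : linfun vsval = 0 :> 'Hom(subvs_of (lker f), U).
  apply: mf; apply/lfunP=> x.
  rewrite /= comp_lfunE lfunE comp_lfun0r zero_lfunE /=.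
  by apply/eqP; rewrite -memv_ker subvsP.
rewrite -subv0; apply/subvP=> u fu.
by have := e (Subvs fu); rewrite lfunE zero_lfunE /= => ->; apply: mem0v.
Qed.

Lemma vect_epiP (U V : vectType K) (f : 'Hom(U, V)) :
  @is_epi K VectCat U V f -> limg f = fullv.
Proof.
move=> ef; have /lfunP e : \1%VF - projv (limg f) = 0 :> 'End(V).
  apply: ef; apply/lfunP=> x.
  rewrite /= !(comp_lfunE, add_lfunE, opp_lfunE, id_lfunE, zero_lfunE).
  by rewrite projv_id ?subrr // memv_img ?memvf.
apply/eqP; rewrite eqEsubv subvf /=; apply/subvP=> v _.
have /eqP := e v; rewrite zero_lfunE add_lfunE opp_lfunE id_lfunE.
by rewrite subr_eq0 => /eqP ->; apply: memv_proj.
Qed.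

Lemma vect_kernel (U V : vectType K) (f : 'Hom(U, V)) :
  @is_kernel K VectCat U V (subvs_of (lker f)) f (linfun vsval).
Proof.
split=> [|T h fh0].
  apply/lfunP=> x; rewrite /= comp_lfunE lfunE zero_lfunE /=.
  by apply/eqP; rewrite -memv_ker subvsP.
have hk x : h x \in lker f.
  by rewrite memv_ker -comp_lfunE; move/lfunP/(_ x): fh0 => /= ->; rewrite zero_lfunE.
exists (linfun (vsproj (lker f)) \o h)%VF; split.
  by apply/lfunP=> x; rewrite /= !comp_lfunE !lfunE /= vsprojK.
move=> u <-; apply/lfunP=> x; rewrite /= !comp_lfunE !lfunE /=.
exact: vsvalK.
Qed.

Lemma vect_kernel_mono (U V : vectType K) (f : 'Hom(U, V)) (W : vectType K)
    (g : 'Hom(V, W)) : lker f == 0%VS -> lker g = limg f ->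
  @is_kernel K VectCat V W U g f.
Proof.
move=> kf kg; split=> [|T h gh0].
  apply/lfunP=> x; rewrite /= comp_lfunE zero_lfunE.
  by apply/eqP; rewrite -memv_ker kg memv_img ?memvf.
have hk x : h x \in limg f.
  by rewrite -kg memv_ker -comp_lfunE; move/lfunP/(_ x): gh0 => /= ->;
     rewrite zero_lfunE.
exists (f^-1 \o h)%VF; split.
  by apply/lfunP=> x; rewrite /= !comp_lfunE limg_lfunVK.
by move=> u <- /=; rewrite comp_lfunA lker0_compVf // comp_lfun1l.
Qed.

Lemma vect_cokernel_epi (U V : vectType K) (f : 'Hom(U, V)) (W : vectType K)
    (g : 'Hom(V, W)) : limg g = fullv -> lker g = limg f ->
  @is_cokernel K VectCat U V W f g.
Proof.
move=> ig kg; split=> [|T h hf0].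
  apply/lfunP=> x; rewrite /= comp_lfunE zero_lfunE.
  by apply/eqP; rewrite -memv_ker kg memv_img ?memvf.
have gV w : g ((g^-1)%VF w) = w by rewrite limg_lfunVK // ig memvf.
exists (h \o g^-1)%VF; split.
  apply/lfunP=> x; rewrite /= !comp_lfunE; apply/eqP; rewrite -subr_eq0 -linearB.
  have : (g^-1)%VF (g x) - x \in limg f by rewrite -kg memv_ker linearB /= gV subrr.
  case/memv_imgP=> y _ ->; rewrite /= -comp_lfunE.
  by move/lfunP/(_ y): hf0 => /= ->; rewrite zero_lfunE.
by move=> u <-; apply/lfunP=> w; rewrite /= !comp_lfunE gV.
Qed.

Definition vect_coker (U V : vectType K) (f : 'Hom(U, V)) :
  'Hom(V, subvs_of (limg f)^C) :=
  (linfun (vsproj (limg f)^C) \o (\1 - projv (limg f)))%VF.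

Lemma vect_cokerE (U V : vectType K) (f : 'Hom(U, V)) v :
  vsval (vect_coker f v) = v - projv (limg f) v.
Proof.
rewrite comp_lfunE lfunE /= !(add_lfunE, opp_lfunE, id_lfunE) vsprojK //.
exact: memv_projC.
Qed.

Lemma vect_coker_img (U V : vectType K) (f : 'Hom(U, V)) :
  limg (vect_coker f) = fullv.
Proof.
apply/eqP; rewrite eqEsubv subvf; apply/subvP=> y _.
apply/memv_imgP; exists (vsval y); first exact: memvf.
apply: subvs_inj; rewrite vect_cokerE.
have : vsval y \in (limg f)^C%VS by apply: subvsP.
by move: (vsval y) => v; rewrite -lker_proj memv_ker => /eqP ->; rewrite subr0.
Qed.

Lemma vect_coker_ker (U V : vectType K) (f : 'Hom(U, V)) :
  lker (vect_coker f) = limg f.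
Proof.
apply/vspaceP=> v; rewrite memv_ker; apply/eqP/idP=> [e | vf].
  have := vect_cokerE f v; rewrite e /= => /esym/eqP.
  by rewrite subr_eq0 => /eqP ->; apply: memv_proj.
by apply: subvs_inj; rewrite vect_cokerE projv_id // subrr.
Qed.

Lemma vect_isoP (U V : vectType K) (f : 'Hom(U, V)) :
  lker f == 0%VS -> limg f = fullv -> @is_iso K VectCat U V f.
Proof.
move=> kf imf; exists (f^-1)%VF; split; first exact: lker0_compVf.
by apply/lfunP=> v; rewrite /= comp_lfunE id_lfunE limg_lfunVK // imf memvf.
Qed.

Lemma vect_zeroP (U : vectType K) : \dim {:U} = 0 -> @is_zero K VectCat U.
Proof.
move/eqP; rewrite dimv_eq0 => /eqP U0.
have u0 (u : U) : u = 0 by apply/eqP; rewrite -memv0 -U0 memvf.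
move=> V; split=> f; apply/lfunP=> x; rewrite zero_lfunE; last exact: u0.
by rewrite (u0 x) linear0.
Qed.

Lemma vect_abelian : is_abelian VectCat.
Proof.
split.
- exists (subvs_of (0%VS : {vspace K^o}) : vectType K) => V.
  have u0 (u : subvs_of (0%VS : {vspace K^o})) : u = 0.
    by apply: subvs_inj; apply/eqP; rewrite -memv0 subvsP.
  split=> f; apply/lfunP=> x; rewrite zero_lfunE; last exact: u0.
  by rewrite (u0 x) linear0.
- move=> U V; exists ((U * V)%type : vectType K).
  have l1 : linear (fun u : U => (u, 0) : U * V).
    by move=> a x y; congr pair; rewrite /= scaler0 addr0.
  have l2 : linear (fun v : V => (0, v) : U * V).
    by move=> a x y; congr pair; rewrite /= scaler0 addr0.
  have l3 : linear (fun x : U * V => x.1) by [].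
  have l4 : linear (fun x : U * V => x.2) by [].
  exists (linfun (fun u : U => (u, 0) : U * V)), (linfun (fun v : V => (0, v) : U * V)).
  exists (linfun (fun x : U * V => x.1)), (linfun (fun x : U * V => x.2)).
  split; apply/lfunP=> x /=;
    rewrite ?(add_lfunE, comp_lfunE, id_lfunE, zero_lfunE).
  + by rewrite (lfunE_lin l1) (lfunE_lin l3).
  + by rewrite (lfunE_lin l2) (lfunE_lin l4).
  + by rewrite (lfunE_lin l2) (lfunE_lin l3).
  + by rewrite (lfunE_lin l1) (lfunE_lin l4).
  + rewrite (lfunE_lin l1) (lfunE_lin l3) (lfunE_lin l2) (lfunE_lin l4).
    by case: x => u v; congr pair; rewrite /= ?addr0 ?add0r.
- by move=> U V f; exists (subvs_of (lker f) : vectType K), (linfun vsval); apply: vect_kernel.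
- move=> U V f; exists (subvs_of (limg f)^C : vectType K), (vect_coker f).
  by apply: vect_cokernel_epi; [apply: vect_coker_img | apply: vect_coker_ker].
- move=> U V f /vect_monoP kf; exists (subvs_of (limg f)^C : vectType K), (vect_coker f).
  by apply: vect_kernel_mono => //; apply: vect_coker_ker.
- move=> U V f /vect_epiP imf; exists (subvs_of (lker f) : vectType K), (linfun vsval).
  apply: vect_cokernel_epi => //.
  apply/vspaceP=> v; apply/idP/memv_imgP=> [vk | [y _ ->]].
    by exists (Subvs vk); rewrite ?memvf // lfunE.
  by rewrite lfunE subvsP.
Qed.

Lemma vect_line_simple : @is_simple K VectCat (K^o : vectType K).
Proof.
split=> [z | U f /vect_monoP kf].
  have [/(_ \1%VF)/lfunP/(_ (1 : K^o))] := z (K^o : vectType K).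
  by rewrite id_lfunE zero_lfunE => /eqP; rewrite oner_eq0.
have := limg_dim_eq (f := f) (U := fullv); rewrite (eqP kf) capv0 => /(_ erefl) e.
have : (\dim (limg f) <= \dim {:(K^o : vectType K)})%N by apply: dimvS; apply: subvf.
rewrite [\dim {:K^o}]dimvf /= leq_eqVlt ltnS leqn0 => /orP[/eqP d | /eqP d].
  right; apply: vect_isoP => //; apply/eqP; rewrite eqEdim subvf.
  by rewrite [\dim {:K^o}]dimvf d leqnn.
by left; apply: vect_zeroP; rewrite -e.
Qed.

Lemma vect_projective (P : VectCat) : projective P.
Proof.
move=> U V e f /vect_epiP ime; exists (e^-1 \o f)%VF; apply/lfunP=> x.
by rewrite /= !comp_lfunE limg_lfunVK // ime memvf.
Qed.

Lemma vect_simple_line (U : vectType K) : @is_simple K VectCat U ->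
  exists f : 'Hom(K^o, U), @is_iso K VectCat (K^o : vectType K) U f.
Proof.
move=> [nz simp].
have [u u0] : exists u : U, u != 0.
  have U0 : (fullv : {vspace U}) != 0%VS.
    by apply/eqP=> e; apply: nz; apply: vect_zeroP; rewrite e dimv0.
  by exists (vpick fullv); rewrite vpick0.
have lin : linear (fun a : K^o => (a : K) *: u).
  by move=> a x y; rewrite scalerDl scalerA.
exists (linfun (fun a : K^o => (a : K) *: u)).
case: (simp (K^o : vectType K) (linfun (fun a : K^o => (a : K) *: u))) => //.
  move=> T g h /lfunP e; apply/lfunP=> x.
  have := e x; rewrite /= !comp_lfunE !(lfunE_lin lin) => /eqP.
  by rewrite -subr_eq0 -scalerBl scaler_eq0 (negPf u0) orbF subr_eq0 => /eqP.
by case: vect_line_simple => n _ z; case: (n z).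
Qed.

Lemma vect_semisimple : is_semisimple VectCat.
Proof.
move=> U; exists (\dim {:U}), (fun=> (K^o : vectType K)).
have lin (i : 'I_(\dim {:U})) : linear (fun a : K^o => (a : K) *: ebas i).
  by move=> a x y; rewrite scalerDl scalerA.
exists (fun i => linfun (fun a : K^o => (a : K) *: ebas i)), (fun i => ecoord i).
have fr : free (vbasis {:U}) by apply: (basis_free (vbasisP _)).
have cE (i : 'I_(\dim {:U})) (u : U) : ecoord i u = coord (vbasis {:U}) i u.
  by rewrite /ecoord lfunE_lin //; apply: linearP.
split; first by move=> _; apply: vect_line_simple.
split.
- move=> j; apply/lfunP=> a; rewrite /= comp_lfunE id_lfunE (lfunE_lin (lin j)) linearZ.
  by rewrite /= cE coord_free // eqxx; apply: mulr1.
- move=> j l jl; apply/lfunP=> a; rewrite /= comp_lfunE zero_lfunE (lfunE_lin (lin j)) linearZ.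
  rewrite /= cE coord_free //.
  have -> : (j == l) = false by apply/eqP.
  exact: mulr0.
- apply/lfunP=> u; rewrite sum_lfunE /= id_lfunE {2}(ebas_sum u).
  by apply: eq_bigr => i _; rewrite comp_lfunE (lfunE_lin (lin i)).
Qed.

Lemma vect_finite_length (U : VectCat) : finite_length U.
Proof.
have [n] := ubnP (\dim {:(U : vectType K)}); elim: n U => // n IH U dU.
case: (posnP (\dim {:(U : vectType K)})) => [d0 | d0].
  by apply: finite_length_zero; apply: vect_zeroP.
pose p : 'Hom(U, K^o) := ecoord (Ordinal d0).
have p0 : p != 0.
  apply/lfunPn; exists (ebas (Ordinal d0)).
  rewrite zero_lfunE /p /ecoord lfunE_lin; last exact: linearP.
  rewrite coord_free ?eqxx ?oner_eq0 //; exact: (basis_free (vbasisP _)).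
have imp : limg p = fullv.
  apply/eqP; rewrite eqEdim subvf [\dim {:K^o}]dimvf /= lt0n dimv_eq0.
  apply: contra_neqN p0 => /eqP e; apply/lfunP=> x; rewrite zero_lfunE.
  by apply/eqP; rewrite -memv0 -e memv_img ?memvf.
apply: (@finite_length_ext K VectCat U (subvs_of (lker p) : vectType K) (K^o : vectType K)
  (linfun vsval) p).
- exact: vect_kernel.
- apply: vect_cokernel_epi => //.
  apply/vspaceP=> v; apply/idP/memv_imgP=> [vk | [y _ ->]].
    by exists (Subvs vk); rewrite ?memvf // lfunE.
  by rewrite lfunE subvsP.
- exact: vect_line_simple.
- apply: IH; rewrite dimvf /=.
  have := limg_ker_dim p fullv; rewrite capfv imp [\dim {:K^o}]dimvf /= => e.
  by move: dU; rewrite -e addn1 ltnS.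
Qed.

Lemma vect_finite : is_finite VectCat.
Proof.
split; first exact: vect_finite_length.
  move=> U; exists U, \1%VF; split; first exact: vect_projective.
  by move=> T g h /=; rewrite !comp_lfun1r.
exists 1%N, (fun=> (K^o : vectType K)) => U /vect_simple_line[f isof].
by exists ord0, f.
Qed.

Lemma vect_dual_pair (I : finType) (X Y : vectType K) (x : I -> X) (y : I -> Y)
    (p : Y -> X -> K^o) : bilinear2 p ->
    (forall v, v = \sum_i (p (y i) v : K) *: x i) ->
    (forall w, w = \sum_i (p w (x i) : K) *: y i) ->
  @is_dual K VectMon Y X.
Proof.
move=> bp hx hy; exists (tlift p).
have lin : linear (fun a : K^o => (a : K) *: \sum_i pure (x i) (y i)).
  by move=> a b c; rewrite scalerDl scalerA.
exists (linfun (fun a : K^o => (a : K) *: \sum_i pure (x i) (y i))).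
split.
  apply: tens_ext => a v; rewrite /= !tensE (lfunE_lin lin).
  rewrite pure_scll pure_suml !linearZ /= !linear_sum /= {2}(hx v) scaler_sumr.
  by apply: eq_bigr => i _; rewrite !tensE tliftE.
apply: tens_ext => w a; rewrite /= !tensE (lfunE_lin lin).
rewrite pure_sclr pure_sumr !linearZ /= !linear_sum /= {2}(hy w) scaler_sumr.
by apply: eq_bigr => i _; rewrite !tensE tliftE.
Qed.

Lemma vect_rigid : is_rigid VectMon.
Proof.
move=> U; split; exists (vdual U).
  apply: (@vect_dual_pair _ U (vdual U) (@ebas K U) (@ecoord K U)
            (fun f u => (f : vdual U) u)).
  - by split=> [u | f] a g h; rewrite ?linearP // add_lfunE scale_lfunE.
  - exact: ebas_sum.
  - exact: ecoord_sum.
apply: (@vect_dual_pair _ (vdual U) U (@ecoord K U) (@ebas K U)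
            (fun u f => (f : vdual U) u)).
- by split=> [u | f] a g h; rewrite ?linearP // add_lfunE scale_lfunE.
- exact: ecoord_sum.
- exact: ebas_sum.
Qed.

Lemma vect_fusion : is_fusion VectMon.
Proof.
split.
- exact: vect_abelian.
- exact: vect_finite.
- exact: vect_semisimple.
- exact: vect_rigid.
- exact: vect_line_simple.
Qed.

Definition Vect : fusionCat K := FusionCat vect_fusion.

Definition VectModule : leftModule Vect.
Proof.
refine (@LeftModule K VectMon VectCat vect_abelian vect_ten
  vect_assoc vect_unitl _ _ _ _ _) => /=.
- exact: (@massoc_nat K VectMon).
- exact: (@munitl_nat K VectMon).
- exact: (@mpentagon K VectMon).
- by move=> *; apply: tens_ext3l => a u v; rewrite !tensE pure_scll.
- exact: (@mtriangle K VectMon).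
Defined.

End Vect.

Record fusionQuiver (K : fieldType) (C : fusionCat K) := FusionQuiver {
  qvert : finType;
  qedge : finType;
  qsrc : qedge -> qvert;
  qtgt : qedge -> qvert;
  qlab : qedge -> C
}.

Record rep (K : fieldType) (C : fusionCat K) (M : leftModule C)
    (Q : fusionQuiver C) := MkRep {
  rep_obj :> qvert Q -> M;
  rep_map : forall e : qedge Q,
    mor (act M (qlab e) (rep_obj (qsrc e))) (rep_obj (qtgt e))
}.
Arguments MkRep {K C M Q} rep_obj rep_map.

Section RepCategory.
Variables (K : fieldType) (C : fusionCat K) (M : leftModule C).
Variable Q : fusionQuiver C.
Implicit Types X Y Z : rep M Q.

Definition family X Y : vectType K := dprod (fun v => mor (X v) (Y v)).

(* The subspace rep_mor of the families commuting with the structure maps,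
   described as such in rep_morP. *)
Definition rep_defect X Y (e : qedge Q) (f : family X Y) :
    mor (act M (qlab e) (X (qsrc e))) (Y (qtgt e)) :=
  dapp f (qtgt e) \oc rep_map X e
    - rep_map Y e \oc bmor (act M) (idm (qlab e)) (dapp f (qsrc e)).

Definition rep_mor X Y : {vspace family X Y} :=
  (\bigcap_(e : qedge Q) lker (linfun (@rep_defect X Y e)))%VS.

Lemma rep_defect_lin X Y e : linear (@rep_defect X Y e).
Proof.
move=> a f g; rewrite /rep_defect !dapp_linear mcomp_linl bmor_linr mcomp_linr.
by rewrite scalerBr opprD addrACA.
Qed.

Lemma rep_morP X Y (f : family X Y) :
  (f \in rep_mor X Y) <->
  (forall e, dapp f (qtgt e) \oc rep_map X e =
             rep_map Y e \oc bmor (act M) (idm (qlab e)) (dapp f (qsrc e))).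
Proof.
rewrite memvE.
split=> [/subv_bigcapP fk e | fk].
  have := fk e isT; rewrite -memvE memv_ker (lfunE_lin (@rep_defect_lin X Y e)).
  by rewrite subr_eq0 => /eqP.
apply/subv_bigcapP=> e _; rewrite -memvE memv_ker.
by rewrite (lfunE_lin (@rep_defect_lin X Y e)) subr_eq0; apply/eqP; exact: fk.
Qed.

Definition repHom X Y : vectType K := subvs_of (rep_mor X Y).

Definition rep_comp (X Y : rep M Q) (f : repHom X Y) (v : qvert Q) :
    mor (X v) (Y v) := dapp (vsval f) v.

Definition mk_repHom X Y (f : forall v, mor (X v) (Y v))
    (fP : dprod_of f \in rep_mor X Y) : repHom X Y := Subvs fP.

Lemma rep_compE X Y (f : forall v, mor (X v) (Y v)) fP v :
  rep_comp (@mk_repHom X Y f fP) v = f v.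
Proof. exact: dprod_ofE. Qed.

Lemma rep_compP X Y (f g : repHom X Y) :
  (forall v, rep_comp f v = rep_comp g v) -> f = g.
Proof. by move=> e; apply: subvs_inj; apply/dprodP. Qed.

Lemma rep_comp_lin X Y v : linear (fun f : repHom X Y => rep_comp f v).
Proof. by move=> a f g; rewrite /rep_comp linearP /= dapp_linear. Qed.

Fact rep_id_subproof X : dprod_of (fun v => idm (X v)) \in rep_mor X X.
Proof.
by apply/rep_morP=> e; rewrite !dprod_ofE mcomp1m bmor1 mcompm1.
Qed.
Definition rep_id X : repHom X X := mk_repHom (rep_id_subproof X).

Fact rep_mcomp_subproof X Y Z (g : repHom Y Z) (f : repHom X Y) :
  dprod_of (fun v => rep_comp g v \oc rep_comp f v) \in rep_mor X Z.
Proof.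
apply/rep_morP=> e; rewrite !dprod_ofE.
have /rep_morP/(_ e) fe := subvsP f; have /rep_morP/(_ e) ge := subvsP g.
rewrite -mcompA fe mcompA ge -mcompA -bmorM mcomp1m //.
Qed.
Definition rep_mcomp X Y Z (g : repHom Y Z) (f : repHom X Y) : repHom X Z :=
  mk_repHom (rep_mcomp_subproof g f).

Lemma rep_idE X v : rep_comp (rep_id X) v = idm (X v).
Proof. exact: rep_compE. Qed.
Lemma rep_mcompE X Y Z (g : repHom Y Z) (f : repHom X Y) v :
  rep_comp (rep_mcomp g f) v = rep_comp g v \oc rep_comp f v.
Proof. exact: rep_compE. Qed.

Definition Rep : linCat K.
Proof.
refine (@LinCat K (rep M Q) repHom rep_id rep_mcomp _ _ _ _ _).
- move=> X Y Z W h g f; apply: rep_compP => v.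
  by rewrite !rep_mcompE mcompA.
- by move=> X Y f; apply: rep_compP => v; rewrite rep_mcompE rep_idE mcomp1m.
- by move=> X Y f; apply: rep_compP => v; rewrite rep_mcompE rep_idE mcompm1.
- move=> X Y Z f a g h; apply: rep_compP => v.
  by rewrite rep_comp_lin !rep_mcompE rep_comp_lin mcomp_linl.
- move=> X Y Z g a f h; apply: rep_compP => v.
  by rewrite rep_comp_lin !rep_mcompE rep_comp_lin mcomp_linr.
Defined.

End RepCategory.
Arguments Rep {K C} M Q.

Section Unfolding.
Variables (K : fieldType) (C : fusionCat K) (M : leftModule C).
Variables (Q : fusionQuiver C) (I : irr M).

(* Triples (e, L, L') such that L' is a direct summand of act (Pi_e) L. *)
Definition unfolded_edge : finType :=
  {x : qedge Q * irr_index I * irr_index I |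
    `[< direct_summand (I x.2) (act M (qlab x.1.1) (I x.1.2)) >]}.

Definition unfolded_lab (x : unfolded_edge) : Vect K :=
  mor (I (val x).2) (act M (qlab (val x).1.1) (I (val x).1.2)).

Definition unfolded : fusionQuiver (Vect K) := {|
  qvert := (qvert Q * irr_index I)%type;
  qedge := unfolded_edge;
  qsrc := fun x => (qsrc (val x).1.1, (val x).1.2);
  qtgt := fun x => (qtgt (val x).1.1, (val x).2);
  qlab := unfolded_lab
|}.

Definition F_obj (X : rep M Q) : rep (VectModule K) unfolded :=
  @MkRep K (Vect K) (VectModule K) unfolded
    (fun v => mor (I v.2) (X v.1))
    (fun x => tlift
      (fun (alpha : mor (I (val x).2) (act M (qlab (val x).1.1) (I (val x).1.2)))
           (beta : mor (I (val x).1.2) (X (qsrc (val x).1.1))) =>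
         rep_map X (val x).1.1
           \oc bmor (act M) (idm (qlab (val x).1.1)) beta \oc alpha)).

Definition F_comp (X Y : rep M Q) (f : repHom X Y) (v : qvert unfolded) :
    'Hom(F_obj X v, F_obj Y v) :=
  linfun (fun alpha : mor (I v.2) (X v.1) => rep_comp f v.1 \oc alpha).

Fact F_subproof (X Y : rep M Q) (f : repHom X Y) :
  dprod_of (F_comp f) \in rep_mor (F_obj X) (F_obj Y).
Proof.
apply/rep_morP=> -[[[e L] L'] eP]; rewrite !dprod_ofE /= /unfolded_lab /=.
have bil (Z : rep M Q) : bilinear2 (fun (alpha : mor (I L') (act M (qlab e) (I L)))
    (beta : mor (I L) (Z (qsrc e))) =>
      rep_map Z e \oc bmor (act M) (idm (qlab e)) beta \oc alpha).
  split=> w a g h; first by rewrite mcomp_linr.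
  by rewrite bmor_linr mcomp_linr mcomp_linl.
apply: tens_ext => alpha beta; rewrite !comp_lfunE tmapE !tliftE //.
rewrite id_lfunE /F_comp !(lfunE_lin (@mcomp_linr _ _ _ _ _ _)) /=.
have /rep_morP/(_ e) fe := subvsP f.
rewrite !mcompA fe -[idm (qlab e)]mcomp1m bmorM mcomp1m !mcompA //.
Qed.

Definition F_functor : linFunctor (Rep M Q) (Rep (VectModule K) unfolded).
Proof.
refine (@LinFunctor K (Rep M Q) (Rep (VectModule K) unfolded) F_obj
  (fun X Y f => mk_repHom (F_subproof f)) _ _ _).
- move=> X Y a f g; apply: rep_compP => v; rewrite rep_comp_lin !rep_compE.
  apply/lfunP=> alpha; rewrite add_lfunE scale_lfunE.
  by rewrite /F_comp !(lfunE_lin (@mcomp_linr _ _ _ _ _ _)) rep_comp_lin mcomp_linl.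
- move=> X; apply: rep_compP => v; rewrite rep_compE rep_idE.
  apply/lfunP=> alpha; rewrite /F_comp (lfunE_lin (@mcomp_linr _ _ _ _ _ _)).
  by rewrite rep_idE mcomp1m id_lfunE.
- move=> X Y Z g f; apply: rep_compP => v; rewrite rep_compE rep_mcompE !rep_compE.
  apply/lfunP=> alpha; rewrite comp_lfunE.
  by rewrite /F_comp !(lfunE_lin (@mcomp_linr _ _ _ _ _ _)) rep_mcompE mcompA.
Defined.

End Unfolding.

(* Main.v *)
Require Import Defs.
From mathcomp Require Import all_boot all_algebra.
From mathcomp Require Import boolp.

(** Over an algebraically closed field the simple objects [I l] of [M] satisfy
    Schur's lemma, so an object of the semisimple category [M] is the same thing
    as its family of multiplicity spaces [mor (I l) X], and a map [Z -> X] is the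
    same thing as an arbitrary family of linear maps
    [mor (I l) Z -> mor (I l) X]: such a family is automatically compatible with
    maps between the [I l], which are all scalars or zero ([irr_lift],
    [irr_ext]).  The functor [F] therefore replaces every [X_v] by an equivalent
    datum, and only the structure maps have to be compared.

    A map out of [act Pi (X_s)] is determined by its composites with
    [act Pi beta \oc alpha], where [beta : I l -> X_s] and
    [alpha : I l' -> act Pi (I l)] ([act_irr_ext]); its components at these pairs
    are exactly the linear maps that [F] puts on the edges of the unfolded
    quiver.  No information is lost by keeping an edge only when [I l'] is a
    direct summand of [act Pi (I l)], because otherwise there is no nonzero
    [alpha] ([irr_summand]).  It is convenient to let the missing edges act by
    zero, so that every triple [(e, l, l')] acts ([edge_action]).  Faithfulness
    and fullness follow.  For essential surjectivity a representation [W] of the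
    unfolded quiver is folded back: [X_v] is the direct sum of
    [\dim (W (v, l))] copies of [I l], over all [l], and [irr_lift] produces its
    structure maps.

    Representation categories are abelian because kernels and cokernels are
    computed vertex by vertex.  For kernels this is formal.  A cokernel inherits
    structure maps because acting by an object [B] preserves cokernels: [B] has a
    dual, so the action of [B] is a left adjoint ([act_adjunction],
    [act_cokernel]).  This covers both representation categories in the
    theorem. *)

Set Implicit Arguments.
Unset Strict Implicit.
Unset Printing Implicit Defensive.

Import GRing.Theory.
Local Open Scope ring_scope.
Local Open Scope cat_scope.

(** * Linear and abelian categories *)

Section LinearCalculus.
Variables (K : fieldType) (A : linCat K).

Lemma linear_subE (U V : vectType K) (f : U -> V) : linear f ->
  forall x y, f (x - y) = f x - f y.
Proof. by move=> lin x y; rewrite -(lfunE_lin lin) linearB /= !lfunE_lin. Qed.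

Lemma linear_addE (U V : vectType K) (f : U -> V) : linear f ->
  forall x y, f (x + y) = f x + f y.
Proof. by move=> lin x y; rewrite -(lfunE_lin lin) linearD /= !lfunE_lin. Qed.

Lemma linear_0E (U V : vectType K) (f : U -> V) : linear f -> f 0 = 0.
Proof. by move=> lin; rewrite -(lfunE_lin lin) linear0. Qed.

Implicit Types X Y Z : A.

Lemma mcomp0m X Y Z (f : mor X Y) : (0 : mor Y Z) \oc f = 0.
Proof. exact: (linear_0E (mcomp_linl f)). Qed.
Lemma mcompm0 X Y Z (g : mor Y Z) : g \oc (0 : mor X Y) = 0.
Proof. exact: (linear_0E (mcomp_linr g)). Qed.
Lemma mcompBl X Y Z (g h : mor Y Z) (f : mor X Y) :
  (g - h) \oc f = g \oc f - h \oc f.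
Proof. exact: (linear_subE (mcomp_linl f)). Qed.
Lemma mcompBr X Y Z (g : mor Y Z) (f h : mor X Y) :
  g \oc (f - h) = g \oc f - g \oc h.
Proof. exact: (linear_subE (mcomp_linr g)). Qed.
Lemma mcompDl X Y Z (g h : mor Y Z) (f : mor X Y) :
  (g + h) \oc f = g \oc f + h \oc f.
Proof. exact: (linear_addE (mcomp_linl f)). Qed.
Lemma mcompDr X Y Z (g : mor Y Z) (f h : mor X Y) :
  g \oc (f + h) = g \oc f + g \oc h.
Proof. exact: (linear_addE (mcomp_linr g)). Qed.
Lemma mcompZl X Y Z a (g : mor Y Z) (f : mor X Y) :
  (a *: g) \oc f = a *: (g \oc f).
Proof. exact: (linear_scale (mcomp_linl f)). Qed.
Lemma mcompZr X Y Z a (g : mor Y Z) (f : mor X Y) :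
  g \oc (a *: f) = a *: (g \oc f).
Proof. exact: (linear_scale (mcomp_linr g)). Qed.
Lemma mcomp_suml (J : finType) X Y Z (g : J -> mor Y Z) (f : mor X Y) :
  (\sum_j g j) \oc f = \sum_j g j \oc f.
Proof. exact: (linear_sumE (mcomp_linl f)). Qed.
Lemma mcomp_sumr (J : finType) X Y Z (g : mor Y Z) (f : J -> mor X Y) :
  g \oc (\sum_j f j) = \sum_j g \oc f j.
Proof. exact: (linear_sumE (mcomp_linr g)). Qed.

Lemma iso_monic X Y (f : mor X Y) : is_iso f -> is_mono f.
Proof.
move=> [g [gf _]] T u v e.
by rewrite -(mcomp1m u) -gf -mcompA e mcompA gf mcomp1m.
Qed.

Lemma is_zero_idm X : idm X = 0 -> is_zero X.
Proof.
move=> e Y; split=> f; first by rewrite -(mcompm1 f) e mcompm0.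
by rewrite -(mcomp1m f) e mcomp0m.
Qed.

Lemma is_iso_inverse X Y (f : mor X Y) : is_iso f -> exists g : mor Y X, is_iso g.
Proof. by move=> [g [gf fg]]; exists g, f. Qed.

Definition iso_of_is_iso X Y (f : mor X Y) (isof : is_iso f) : iso X Y :=
  let: exist g gP := cid isof in Iso gP.1 gP.2.

Lemma kernel_mono X Y N (f : mor X Y) (k : mor N X) : is_kernel f k -> is_mono k.
Proof.
move=> [fk0 univ] T g h e.
have [|u [_ uniq]] := univ T (k \oc g); first by rewrite mcompA fk0 mcomp0m.
by rewrite -(uniq g) // -(uniq h).
Qed.

Lemma cokernel_epi X Y N (f : mor X Y) (c : mor Y N) : is_cokernel f c -> is_epi c.
Proof.
move=> [cf0 univ] T g h e.
have [|u [_ uniq]] := univ T (g \oc c); first by rewrite -mcompA cf0 mcompm0.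
by rewrite -(uniq g) // -(uniq h).
Qed.

Lemma mono_kernel0 X Y N (f : mor X Y) (k : mor N X) :
  is_mono f -> is_kernel f k -> k = 0.
Proof. by move=> mf [fk0 _]; apply: mf; rewrite fk0 mcompm0. Qed.

Lemma epi_cokernel0 X Y N (f : mor X Y) (c : mor Y N) :
  is_epi f -> is_cokernel f c -> c = 0.
Proof. by move=> ef [cf0 _]; apply: ef; rewrite cf0 mcomp0m. Qed.

Lemma kernel0_mono X Y N (f : mor X Y) (k : mor N X) :
  is_kernel f k -> k = 0 -> is_mono f.
Proof.
move=> [_ univ] k0 T g h e.
have [|u [ku _]] := univ T (g - h); first by rewrite mcompBr e subrr.
by apply/eqP; rewrite -subr_eq0 -ku k0 mcomp0m.
Qed.

Lemma cokernel0_epi X Y N (f : mor X Y) (c : mor Y N) :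
  is_cokernel f c -> c = 0 -> is_epi f.
Proof.
move=> [_ univ] c0 T g h e.
have [|u [uc _]] := univ T (g - h); first by rewrite mcompBl e subrr.
by apply/eqP; rewrite -subr_eq0 -uc c0 mcompm0.
Qed.

Hypothesis abA : is_abelian A.

(** [f] is the kernel of some [g]; since [g] kills [f], it factors through the
    cokernel [c], so whatever [c] kills is killed by [g] as well. *)
Lemma mono_kernel_of_cokernel X Y N (f : mor X Y) (c : mor Y N) :
  is_mono f -> is_cokernel f c -> is_kernel c f.
Proof.
move=> mf [cf0 univ]; have [Z [g [gf0 kuniv]]] := abelian_mono abA mf.
split=> // T h ch0; apply: kuniv.
have [w [<- _]] := univ Z g gf0.
by rewrite -mcompA ch0 mcompm0.
Qed.

Lemma epi_cokernel_of_kernel X Y N (f : mor X Y) (k : mor N X) :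
  is_epi f -> is_kernel f k -> is_cokernel k f.
Proof.
move=> ef [fk0 univ]; have [Z [g [fg0 kuniv]]] := abelian_epi abA ef.
split=> // T h hk0; apply: kuniv.
have [w [<- _]] := univ Z g fg0.
by rewrite mcompA hk0 mcomp0m.
Qed.

(** The complement is the kernel of the retraction, since the idempotent
    [idm S - i \oc r] factors through it. *)
Lemma split_mono_summand X S (i : mor X S) (r : mor S X) :
  r \oc i = idm X -> direct_summand X S.
Proof.
move=> ri; have [N [k kk]] := abelian_kernel abA r.
have [|q [kq _]] := kk.2 S (idm S - i \oc r).
  by rewrite mcompBr mcompm1 mcompA ri mcomp1m subrr.
exists N, i, k, r, q; split=> //.
- apply: (kernel_mono kk).
  by rewrite mcompA kq mcompBl mcomp1m -mcompA kk.1 mcompm0 subr0 mcompm1.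
- exact: kk.1.
- apply: (kernel_mono kk).
  by rewrite mcompA kq mcompBl mcomp1m -mcompA ri mcompm1 subrr mcompm0.
- by rewrite kq addrC subrK.
Qed.

(** The induction runs over a duplicate-free list of indices, while the
    injections and projections are total families whose values off the list are
    zero; [dfwith] overrides them at the index being added. *)
Lemma partial_direct_sum (J : finType) (X : J -> A) (r : seq J) : uniq r ->
  exists (S : A) (i : forall j, mor (X j) S) (p : forall j, mor S (X j)),
  [/\ {in r, forall j, p j \oc i j = idm (X j)},
      forall j l, j <> l -> p l \oc i j = 0
    & \sum_(j <- r) i j \oc p j = idm S].
Proof.
elim: r => [_ | j0 r IH /= /andP[j0r /IH[S [i [p [pii pil sip]]]]]].
  have [S zS] := abelian_zero abA.
  exists S, (fun=> 0), (fun=> 0); split=> // [j l _|]; first exact: mcompm0.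
  by rewrite big_nil; apply/esym/(zS S).1.
have [S' [iX [iY [pX [pY [XX YY XY YX XYS]]]]]] := abelian_biproduct abA (X j0) S.
pose i' := dfwith (fun j => iY \oc i j) iX.
pose p' := dfwith (fun j => p j \oc pY) pX.
have i'0 : i' j0 = iX by apply: dfwith_in.
have p'0 : p' j0 = pX by apply: dfwith_in.
have i'E j : j0 != j -> i' j = iY \oc i j by move=> ?; apply: dfwith_out.
have p'E j : j0 != j -> p' j = p j \oc pY by move=> ?; apply: dfwith_out.
have j0P j : j \in r -> j0 != j by apply: contraTneq => <-.
exists S', i', p'; split=> [j||].
- rewrite inE; case: eqVneq => [-> _ | nj /= jr]; first by rewrite i'0 p'0.
  by rewrite i'E 1?eq_sym // p'E 1?eq_sym // -mcompA (mcompA pY) YY mcomp1m pii.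
- move=> j l jl; case: (eqVneq j0 j) => [ej | nj].
    have nl : j0 != l by rewrite ej; apply/eqP.
    by subst j; rewrite i'0 p'E // -mcompA YX mcompm0.
  rewrite i'E //; case: (eqVneq j0 l) => [el | nl].
    by subst l; rewrite p'0 mcompA XY mcomp0m.
  by rewrite p'E // -mcompA (mcompA pY) YY mcomp1m pil.
- rewrite big_cons i'0 p'0 -XYS; congr (_ + _).
  transitivity (\sum_(j <- r) iY \oc (i j \oc p j) \oc pY).
    rewrite big_seq [RHS]big_seq; apply: eq_bigr => j /j0P nj.
    by rewrite i'E // p'E // !mcompA.
  rewrite -[iY in RHS]mcompm1 -sip.
  by elim/big_rec2: _ => [|j u v _ ->]; rewrite ?mcompm0 ?mcomp0m // mcompDr mcompDl.
Qed.

Lemma direct_sum_exists (J : finType) (X : J -> A) :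
  exists (S : A) (i : forall j, mor (X j) S) (p : forall j, mor S (X j)),
  is_direct_sum i p.
Proof.
have [S [i [p [pii pil sip]]]] := partial_direct_sum X (index_enum_uniq J).
by exists S, i, p; split=> // j; apply: pii; apply: mem_index_enum.
Qed.

End LinearCalculus.

(** * Exactness of the action of a dualizable object *)

Section ActionExactness.
Variables (K : fieldType) (C : monCat K) (M : leftModule C).
Notation "f ⊗ g" := (bmor (act M) f g) (at level 35).

Lemma act1M (B : C) (X Y Z : M) (g : mor Y Z) (f : mor X Y) :
  idm B ⊗ (g \oc f) = idm B ⊗ g \oc idm B ⊗ f.
Proof. by rewrite -bmorM mcomp1m. Qed.

Lemma actM1 (B B' B'' : C) (X : M) (g : mor B' B'') (f : mor B B') :
  (g \oc f) ⊗ idm X = g ⊗ idm X \oc f ⊗ idm X.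
Proof. by rewrite -bmorM mcomp1m. Qed.

(** Evaluation and coevaluation make the action of [B] right adjoint to that of
    [A].  The triangle identity given here is the one that recovers a map out of
    [act M A Y] from its transpose. *)
Lemma act_adjunction (A B : C) : is_dual A B ->
  exists (eta : forall Y : M, mor Y (act M B (act M A Y)))
         (eps : forall T : M, mor (act M A (act M B T)) T),
  [/\ forall (Y Y' : M) (f : mor Y Y'),
        eta Y' \oc f = idm B ⊗ (idm A ⊗ f) \oc eta Y,
      forall (T T' : M) (h : mor T T'),
        eps T' \oc idm A ⊗ (idm B ⊗ h) = h \oc eps T
    & forall Y : M, eps (act M A Y) \oc idm A ⊗ eta Y = idm (act M A Y)].
Proof.
move=> [ev [coev [_ zigzag]]].
exists (fun Y => lm_assoc B A Y \oc coev ⊗ idm Y \oc iso_inv (lm_unit Y)).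
exists (fun T => lm_unit T \oc ev ⊗ idm T \oc iso_inv (lm_assoc A B T)).
split=> [Y Y' f | T T' h | Y].
- have unitV : iso_inv (lm_unit Y') \oc f = idm _ ⊗ f \oc iso_inv (lm_unit Y).
    rewrite -[LHS]mcompm1 -(iso_morK (lm_unit Y)) !mcompA.
    by rewrite -(mcompA _ f) -lm_unit_nat mcompA iso_invK mcomp1m.
  rewrite -mcompA unitV !mcompA -lm_assoc_nat bmor1 -!mcompA.
  by congr (_ \oc _); rewrite !mcompA -!bmorM !mcomp1m !mcompm1.
- have assocV : iso_inv (lm_assoc A B T') \oc idm A ⊗ (idm B ⊗ h) =
      idm _ ⊗ h \oc iso_inv (lm_assoc A B T).
    rewrite -[LHS]mcompm1 -(iso_morK (lm_assoc A B T)) !mcompA.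
    by rewrite -(mcompA _ (_ ⊗ _)) -lm_assoc_nat mcompA iso_invK mcomp1m bmor1.
  rewrite -mcompA assocV !mcompA -lm_unit_nat -!mcompA; congr (_ \oc _).
  by rewrite !mcompA -!bmorM !mcomp1m !mcompm1.
(* The coherence axioms are equations between maps out of (A \otimes 1) Y, so
   the triangle identity is checked after precomposition with the invertible map
   u; the pentagon then moves everything inside the first argument of the action,
   where the zigzag identity of the duality applies. *)
pose r := munitr A; pose u := r ⊗ idm Y; pose v := iso_inv r ⊗ idm Y.
have uv : u \oc v = idm _ by rewrite -bmorM iso_morK mcomp1m bmor1.
have pent : idm A ⊗ lm_assoc B A Y \oc lm_assoc A (ten C B A) Y =
    lm_assoc A B (act M A Y) \oc lm_assoc (ten C A B) A Y
      \oc iso_inv (massoc A B A) ⊗ idm Y.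
  rewrite -lm_pentagon -!mcompA -actM1 iso_morK bmor1.
  by rewrite mcompm1.
have u_epi (g h : mor (act M A Y) (act M A Y)) : g \oc u = h \oc u -> g = h.
  by move=> e; rewrite -(mcompm1 g) -uv mcompA e -mcompA uv mcompm1.
apply: u_epi; rewrite mcomp1m.
rewrite {1}/u -lm_unitr !act1M !mcompA.
rewrite -(mcompA _ (idm A ⊗ iso_inv (lm_unit Y))) -act1M iso_invK bmor1 mcompm1.
rewrite -(mcompA _ (idm A ⊗ (coev ⊗ idm Y))) -lm_assoc_nat !mcompA.
rewrite -(mcompA _ (idm A ⊗ _)) pent !mcompA.
rewrite -(mcompA _ (iso_inv (lm_assoc _ _ _))) iso_invK mcompm1.
rewrite -(bmor1 (act M) A Y) -(mcompA _ (ev ⊗ _)) -lm_assoc_nat mcompA lm_unitl.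
by rewrite -!actM1 zigzag.
Qed.

(** A map [h] out of [act M A Y] that kills [idm A ⊗ f] has a transpose
    [Y -> act M B T] that kills [f]; factor the transpose through [c] and
    transpose back. *)
Lemma act_cokernel (A B : C) (X Y N : M) (f : mor X Y) (c : mor Y N) :
  is_dual A B -> is_cokernel f c -> is_cokernel (idm A ⊗ f) (idm A ⊗ c).
Proof.
move=> /act_adjunction[eta [eps [etaN epsN tri]]] coker.
split=> [|T h hf0].
  by rewrite -act1M coker.1 (linear_0E (bmor_linr _ _)).
have [|u [uc uniq]] := coker.2 _ (idm B ⊗ h \oc eta Y).
  rewrite -mcompA etaN mcompA -act1M hf0.
  by rewrite (linear_0E (bmor_linr _ _)) mcomp0m.
exists (eps T \oc idm A ⊗ u); split.
  rewrite -mcompA -act1M uc act1M mcompA epsN -mcompA tri.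
  exact: mcompm1.
move=> w wc; rewrite (uniq (idm B ⊗ w \oc eta N)).
  by rewrite act1M mcompA epsN -mcompA tri mcompm1.
by rewrite -mcompA etaN mcompA -act1M wc.
Qed.

End ActionExactness.

(** * Representation categories are abelian *)

Section RepAbelian.
Variables (K : fieldType) (C : fusionCat K) (M : leftModule C).
Variable Q : fusionQuiver C.
Notation R := (Rep M Q).
Notation act1 B f := (bmor (act M) (idm B) f).

Lemma rep_homP (X Y : R) (f : mor X Y) e :
  rep_comp f (qtgt e) \oc rep_map X e
    = rep_map Y e \oc act1 (qlab e) (rep_comp f (qsrc e)).
Proof. by have /rep_morP := subvsP f; apply. Qed.

Lemma rep_hom_exists (X Y : R) (f : forall v, mor (rep_obj X v) (rep_obj Y v)) :
  (forall e, f (qtgt e) \oc rep_map X e = rep_map Y e \oc act1 (qlab e) (f (qsrc e))) ->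
  exists h : mor X Y, forall v, rep_comp h v = f v.
Proof.
move=> fe; have fP : dprod_of f \in rep_mor X Y.
  by apply/rep_morP=> e; rewrite !dprod_ofE.
by exists (mk_repHom fP) => v; apply: rep_compE.
Qed.

Lemma rep_compM (X Y Z : R) (g : mor Y Z) (f : mor X Y) v :
  rep_comp (g \oc f) v = rep_comp g v \oc rep_comp f v.
Proof. exact: rep_mcompE. Qed.

Lemma rep_comp0 (X Y : R) v : rep_comp (0 : mor X Y) v = 0.
Proof. exact: (linear_0E (@rep_comp_lin K C M Q X Y v)). Qed.

Lemma rep_compD (X Y : R) (f g : mor X Y) v :
  rep_comp (f + g) v = rep_comp f v + rep_comp g v.
Proof. exact: (linear_addE (@rep_comp_lin K C M Q X Y v)). Qed.

Lemma rep_comp1 (X : R) v : rep_comp (idm X) v = idm (rep_obj X v).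
Proof. exact: rep_idE. Qed.

Lemma rep_isoP (X Y : R) (f : mor X Y) :
  (forall v, is_iso (rep_comp f v)) -> is_iso f.
Proof.
move=> isof.
have inv v : {g : mor (rep_obj Y v) (rep_obj X v) |
    g \oc rep_comp f v = idm _ /\ rep_comp f v \oc g = idm _} := cid (isof v).
pose g v := sval (inv v).
have gf v : g v \oc rep_comp f v = idm _ by case: (svalP (inv v)).
have fg v : rep_comp f v \oc g v = idm _ by case: (svalP (inv v)).
have [|h hE] := @rep_hom_exists Y X g.
  move=> e; apply: (iso_monic (isof (qtgt e))).
  rewrite !mcompA fg mcomp1m rep_homP -mcompA -bmorM fg mcomp1m bmor1.
  by rewrite mcompm1.
by exists h; split; apply: rep_compP => v; rewrite rep_compM rep_comp1 hE (gf, fg).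
Qed.

Lemma rep_kernel_pointwise (N X Y : R) (f : mor X Y) (k : mor N X) :
  (forall v, is_kernel (rep_comp f v) (rep_comp k v)) -> is_kernel f k.
Proof.
move=> kk; split=> [|T h fh0].
  by apply: rep_compP => v; rewrite rep_compM (kk v).1 rep_comp0.
have [u uE] : exists u : mor T N,
    forall v, rep_comp k v \oc rep_comp u v = rep_comp h v.
  have uex v : {u : mor (rep_obj T v) (rep_obj N v) |
      rep_comp k v \oc u = rep_comp h v}.
    apply: cid; have [|u [uE _]] := (kk v).2 _ (rep_comp h v); last by exists u.
    by rewrite -rep_compM fh0 rep_comp0.
  have [|u uE] := @rep_hom_exists T N (fun v => sval (uex v)).
    move=> e; apply: (kernel_mono (kk (qtgt e))).
    rewrite !mcompA (svalP (uex _)) !rep_homP -mcompA -act1M.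
    by rewrite (svalP (uex _)).
  by exists u => v; rewrite uE (svalP (uex v)).
exists u; split; first by apply: rep_compP => v; rewrite rep_compM.
move=> w wE; apply: rep_compP => v; apply: (kernel_mono (kk v)).
by rewrite uE -wE rep_compM.
Qed.

Lemma act_fusion_cokernel (B : C) (X Y N : M) (f : mor X Y) (c : mor Y N) :
  is_cokernel f c -> is_cokernel (act1 B f) (act1 B c).
Proof.
have [_ [B' BB']] := fusion_rigid (fusionP C) B; exact: act_cokernel BB'.
Qed.

(** The factorizations at the vertices commute with the structure maps because
    [act1 (qlab e) c] is still epi, being a cokernel. *)
Lemma rep_cokernel_pointwise (X Y N : R) (f : mor X Y) (c : mor Y N) :
  (forall v, is_cokernel (rep_comp f v) (rep_comp c v)) -> is_cokernel f c.
Proof.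
move=> cc; split=> [|T h hf0].
  by apply: rep_compP => v; rewrite rep_compM (cc v).1 rep_comp0.
have [u uE] : exists u : mor N T,
    forall v, rep_comp u v \oc rep_comp c v = rep_comp h v.
  have uex v : {u : mor (rep_obj N v) (rep_obj T v) |
      u \oc rep_comp c v = rep_comp h v}.
    apply: cid; have [|u [uE _]] := (cc v).2 _ (rep_comp h v); last by exists u.
    by rewrite -rep_compM hf0 rep_comp0.
  have [|u uE] := @rep_hom_exists N T (fun v => sval (uex v)).
    move=> e; apply: (cokernel_epi (act_fusion_cokernel (qlab e) (cc (qsrc e)))).
    rewrite -!mcompA -act1M (svalP (uex _)) -!rep_homP mcompA.
    by rewrite (svalP (uex _)).
  by exists u => v; rewrite uE (svalP (uex v)).
exists u; split; first by apply: rep_compP => v; rewrite rep_compM.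
move=> w wE; apply: rep_compP => v; apply: (cokernel_epi (cc v)).
by rewrite uE -wE rep_compM.
Qed.

(** The conclusion is stated at the vertices so that [rep_abelian] can read off
    from a kernel in [R] that the components of a mono are monos. *)
Lemma rep_kernel (X Y : R) (f : mor X Y) : exists (N : R) (k : mor N X),
  forall v, is_kernel (rep_comp f v) (rep_comp k v).
Proof.
have kex v : {N : M & {k : mor N (rep_obj X v) | is_kernel (rep_comp f v) k}}.
  have [N kN] := cid (abelian_kernel (lm_abelian M) (rep_comp f v)).
  by exists N; apply: cid.
pose k v := sval (projT2 (kex v)).
have kk v : is_kernel (rep_comp f v) (k v) := svalP (projT2 (kex v)).
have phi e : {p | k (qtgt e) \oc p = rep_map X e \oc act1 (qlab e) (k (qsrc e))}.
  apply: cid; have [|p [pE _]] := (kk (qtgt e)).2 _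
    (rep_map X e \oc act1 (qlab e) (k (qsrc e))); last by exists p.
  rewrite mcompA rep_homP -mcompA -act1M (kk (qsrc e)).1.
  by rewrite (linear_0E (bmor_linr _ _)) mcompm0.
pose N : R := MkRep (fun v => projT1 (kex v)) (fun e => sval (phi e)).
have [|h hE] := @rep_hom_exists N X k.
  by move=> e; rewrite (svalP (phi e)).
by exists N, h => v; rewrite hE; exact: kk.
Qed.

Lemma rep_cokernel (X Y : R) (f : mor X Y) : exists (N : R) (c : mor Y N),
  forall v, is_cokernel (rep_comp f v) (rep_comp c v).
Proof.
have cex v : {N : M & {c : mor (rep_obj Y v) N | is_cokernel (rep_comp f v) c}}.
  have [N cN] := cid (abelian_cokernel (lm_abelian M) (rep_comp f v)).
  by exists N; apply: cid.
pose c v := sval (projT2 (cex v)).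
have cc v : is_cokernel (rep_comp f v) (c v) := svalP (projT2 (cex v)).
have phi e : {p | p \oc act1 (qlab e) (c (qsrc e)) = c (qtgt e) \oc rep_map Y e}.
  apply: cid; have [|p [pE _]] := (act_fusion_cokernel (qlab e) (cc (qsrc e))).2 _
    (c (qtgt e) \oc rep_map Y e); last by exists p.
  by rewrite -mcompA -rep_homP mcompA (cc (qtgt e)).1 mcomp0m.
pose N : R := MkRep (fun v => projT1 (cex v)) (fun e => sval (phi e)).
have [|h hE] := @rep_hom_exists Y N c.
  by move=> e; rewrite (svalP (phi e)).
by exists N, h => v; rewrite hE; exact: cc.
Qed.

Lemma rep_biproduct (X Y : R) : exists (S : R) (iX : mor X S) (iY : mor Y S)
  (pX : mor S X) (pY : mor S Y), is_biproduct iX iY pX pY.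
Proof.
have bex v : {S : M & {b : mor (rep_obj X v) S * mor (rep_obj Y v) S *
    mor S (rep_obj X v) * mor S (rep_obj Y v) |
    is_biproduct b.1.1.1 b.1.1.2 b.1.2 b.2}}.
  have [S bS] := cid (abelian_biproduct (lm_abelian M) (rep_obj X v) (rep_obj Y v)).
  exists S; apply: cid; have [iX [iY [pX [pY b]]]] := bS.
  by exists (iX, iY, pX, pY).
pose b v := sval (projT2 (bex v)).
have bb v : is_biproduct (b v).1.1.1 (b v).1.1.2 (b v).1.2 (b v).2 :=
  svalP (projT2 (bex v)).
pose iX v := (b v).1.1.1; pose iY v := (b v).1.1.2.
pose pX v := (b v).1.2; pose pY v := (b v).2.
pose S : R := MkRep (fun v => projT1 (bex v)) (fun e =>
  iX (qtgt e) \oc rep_map X e \oc act1 (qlab e) (pX (qsrc e))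
  + iY (qtgt e) \oc rep_map Y e \oc act1 (qlab e) (pY (qsrc e))).
have act0 B (V W : M) : act1 B (0 : mor V W) = 0 by exact: (linear_0E (bmor_linr _ _)).
have [|i1 i1E] := @rep_hom_exists X S iX.
  move=> e; have [XX _ _ YX _] := bb (qsrc e).
  by rewrite mcompDl -!mcompA -!act1M XX YX act0 bmor1 !mcompm0 !mcompm1 addr0.
have [|i2 i2E] := @rep_hom_exists Y S iY.
  move=> e; have [_ YY XY _ _] := bb (qsrc e).
  by rewrite mcompDl -!mcompA -!act1M YY XY act0 bmor1 !mcompm0 !mcompm1 add0r.
have [|p1 p1E] := @rep_hom_exists S X pX.
  move=> e; have [XX _ XY _ _] := bb (qtgt e).
  by rewrite mcompDr !mcompA XX XY !mcomp0m mcomp1m addr0.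
have [|p2 p2E] := @rep_hom_exists S Y pY.
  move=> e; have [_ YY _ YX _] := bb (qtgt e).
  by rewrite mcompDr !mcompA YY YX !mcomp0m mcomp1m add0r.
exists S, i1, i2, p1, p2; split; apply: rep_compP => v;
  have [XX YY XY YX XYS] := bb v;
  by rewrite ?rep_compD !rep_compM ?rep_comp0 ?rep_comp1 ?i1E ?i2E ?p1E ?p2E.
Qed.

Lemma rep_zero : exists Z : R, is_zero Z.
Proof.
have [Z zZ] := abelian_zero (lm_abelian M).
exists (MkRep (fun=> Z) (fun=> 0)); apply: is_zero_idm.
by apply: rep_compP => v; rewrite rep_comp1 rep_comp0; apply: (zZ _).1.
Qed.

(** A mono [f] has zero kernel, hence is mono at each vertex, hence is there the
    kernel of its cokernel; dually for epis. *)
Theorem rep_abelian : is_abelian R.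
Proof.
split.
- exact: rep_zero.
- exact: rep_biproduct.
- move=> X Y f; have [N [k kk]] := rep_kernel f.
  by exists N, k; apply: rep_kernel_pointwise.
- move=> X Y f; have [N [c cc]] := rep_cokernel f.
  by exists N, c; apply: rep_cokernel_pointwise.
- move=> X Y f mf; have [N [k kk]] := rep_kernel f.
  have k0 : k = 0 := mono_kernel0 mf (rep_kernel_pointwise kk).
  have [Z [c cc]] := rep_cokernel f.
  exists Z, c; apply: rep_kernel_pointwise => v.
  apply: (mono_kernel_of_cokernel (lm_abelian M)) (cc v).
  by apply: (kernel0_mono (kk v)); rewrite k0 rep_comp0.
- move=> X Y f ef; have [N [c cc]] := rep_cokernel f.
  have c0 : c = 0 := epi_cokernel0 ef (rep_cokernel_pointwise cc).
  have [Z [k kk]] := rep_kernel f.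
  exists Z, k; apply: rep_cokernel_pointwise => v.
  apply: (epi_cokernel_of_kernel (lm_abelian M)) (kk v).
  by apply: (cokernel0_epi (cc v)); rewrite c0 rep_comp0.
Qed.

End RepAbelian.

(** * Equivalences from fully faithful functors *)

Lemma fully_faithful_equivalence (K : fieldType) (A B : linCat K) (F : linFunctor A B) :
  (forall (X Y : A) (f g : mor X Y), fmor F f = fmor F g -> f = g) ->
  (forall (X Y : A) (h : mor (F X) (F Y)), exists f, fmor F f = h) ->
  (forall Y : B, exists (X : A) (f : mor (F X) Y), is_iso f) ->
  is_equivalence F.
Proof.
move=> faithful full ess.
pose Fpre (X Y : A) (h : mor (F X) (F Y)) := sval (cid (full X Y h)).
have FpreK X Y (h : mor (F X) (F Y)) : fmor F (Fpre X Y h) = h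
  := svalP (cid (full X Y h)).
have ex Y : {X : A & iso (F X) Y}.
  have [X isoX] := cid (ess Y); have [f isof] := cid isoX.
  by exists X; apply: iso_of_is_iso isof.
pose G Y := projT1 (ex Y); pose eps Y : iso (F (G Y)) Y := projT2 (ex Y).
pose Gm Y Y' (f : mor Y Y') : mor (G Y) (G Y') :=
  Fpre _ _ (iso_inv (eps Y') \oc f \oc eps Y).
have FGm Y Y' (f : mor Y Y') : fmor F (Gm Y Y' f) =
    iso_inv (eps Y') \oc f \oc eps Y by apply: FpreK.
have Gm_lin Y Y' : linear (Gm Y Y').
  move=> a f g; apply: faithful; rewrite fmor_lin !FGm.
  by rewrite mcompDr mcompDl mcompZr mcompZl.
have Gm1 Y : Gm Y Y (idm Y) = idm (G Y).
  by apply: faithful; rewrite FGm fmor1 mcompm1 iso_invK.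
have GmM X Y Z (g : mor Y Z) (f : mor X Y) : Gm _ _ (g \oc f) = Gm _ _ g \oc Gm _ _ f.
  apply: faithful; rewrite fmorM !FGm !mcompA.
  by rewrite -(mcompA _ (eps Y)) iso_morK mcompm1.
pose eta X := Fpre X (G (F X)) (iso_inv (eps (F X))).
pose etaV X := Fpre (G (F X)) X (eps (F X)).
have etaK X : etaV X \oc eta X = idm X.
  by apply: faithful; rewrite fmorM !FpreK fmor1 iso_morK.
have etaVK X : eta X \oc etaV X = idm (G (F X)).
  by apply: faithful; rewrite fmorM !FpreK fmor1 iso_invK.
exists (LinFunctor Gm_lin Gm1 GmM), (fun X => Iso (etaK X) (etaVK X)), eps.
split=> [X X' f | Y Y' f] /=; last by rewrite FGm !mcompA iso_morK mcomp1m.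
apply: faithful; rewrite !fmorM FGm !FpreK.
by rewrite -[RHS]mcompA iso_morK mcompm1.
Qed.

(** * Schur's lemma and decomposition into simple objects *)

Section Schur.
Import VectorInternalTheory.

Lemma eigenvector_exists (K : closedFieldType) (V : vectType K) (f : V -> V) (v0 : V) :
  linear f -> v0 != 0 -> exists (a : K) (v : V), v != 0 /\ f v = a *: v.
Proof.
move=> lin v0n0; set n := dim V.
pose A : 'M[K]_n := f2mx (linfun f).
have n0 : (0 < n)%N.
  rewrite lt0n; apply: contra v0n0 => /eqP n0.
  apply/eqP/(can_inj v2rK)/rowP=> -[i ilt].
  by exfalso; move: ilt; rewrite -/n n0.
have [|a ra] := @closed_rootP K (char_poly A) _.
  by rewrite size_char_poly eqSS -lt0n.
move: ra; rewrite -eigenvalue_root_char => /eigenvalueP[u ua un0].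
exists a, (@r2v K V u); split.
  by apply: contra un0 => /eqP e; rewrite -(@r2vK K V u) e linear0.
rewrite -(lfunE_lin lin) unlock /fun_of_lfun_def /= r2vK.
by rewrite ua linearZ.
Qed.

Lemma schur_iso (K : fieldType) (A : linCat K) (S S' : A) (f : mor S S') :
  is_abelian A -> is_simple S -> is_simple S' -> f <> 0 -> is_iso f.
Proof.
move=> abA simS simS' fn0; have [N [k kk]] := abelian_kernel abA f.
case: (simS.2 N k (kernel_mono kk)) => [zN | [k' [_ kk']]].
  have k0 : k = 0 := (zN S).1 k.
  by case: (simS'.2 S f (kernel0_mono kk k0)) => // /simS.1.
case: fn0; rewrite -(mcompm1 f) -kk' mcompA kk.1; exact: mcomp0m.
Qed.

(** Composition with [f] is a linear endomorphism of the nonzero space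
    [mor S S].  If [a] is an eigenvalue, [f - a *: idm S] kills a nonzero map, so
    it is not an isomorphism, and therefore vanishes. *)
Lemma schur_scalar (K : closedFieldType) (A : linCat K) (S : A) (f : mor S S) :
  is_abelian A -> is_simple S -> exists a : K, f = a *: idm S.
Proof.
move=> abA simS.
have id0 : idm S != 0 by apply/eqP=> /is_zero_idm /simS.1.
have [a [h [h0 fh]]] := eigenvector_exists (mcomp_linr f) id0.
exists a; apply/eqP; rewrite -subr_eq0; apply/negPn/negP=> /eqP fa0.
have /iso_monic mono_fa := schur_iso abA simS simS fa0.
case/eqP: h0; apply: mono_fa.
by rewrite mcompm0 mcompBl mcompZl mcomp1m fh subrr.
Qed.

End Schur.

Section SimpleCoordinates.
Variables (K : closedFieldType) (A : linCat K).
Hypotheses (abA : is_abelian A) (ssA : is_semisimple A).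
Variable I : irr A.

Lemma irr_decomposition (S : A) : exists (n : nat) (l : 'I_n -> irr_index I)
  (i : forall j, mor (I (l j)) S) (p : forall j, mor S (I (l j))), is_direct_sum i p.
Proof.
have [n [X [i [p [simX [pii pil sip]]]]]] := ssA S.
have rep j : {l : irr_index I & iso (I l) (X j)}.
  have [l isol] := cid (irr_surj I (simX j)).
  by exists l; have [f isof] := cid isol; apply: iso_of_is_iso isof.
pose s j := projT2 (rep j).
exists n, (fun j => projT1 (rep j)), (fun j => i j \oc s j),
  (fun j => iso_inv (s j) \oc p j).
split=> [j | j l jl |].
- by rewrite mcompA -(mcompA _ (p j)) pii mcompm1 iso_invK.
- by rewrite mcompA -(mcompA _ (p l)) pil // mcompm0 mcomp0m.
- rewrite -sip; apply: eq_bigr => j _.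
  by rewrite mcompA -(mcompA _ (s j)) iso_morK mcompm1.
Qed.

Lemma irr_ext (Z X : A) (f g : mor Z X) :
  (forall l (alpha : mor (I l) Z), f \oc alpha = g \oc alpha) -> f = g.
Proof.
move=> e; have [n [l [i [p [_ _ sip]]]]] := irr_decomposition Z.
rewrite -(mcompm1 f) -(mcompm1 g) -sip !mcomp_sumr; apply: eq_bigr => j _.
by rewrite !mcompA e.
Qed.

(** A map between the chosen simple objects is zero or a scalar, so linearity of
    each [g l] is all that naturality asks for. *)
Lemma irr_natural (Z X : A) (g : forall l, mor (I l) Z -> mor (I l) X) :
  (forall l, linear (g l)) ->
  forall l l' (x : mor (I l') Z) (b : mor (I l) (I l')),
  g l (x \oc b) = g l' x \oc b.
Proof.
move=> lin l l' x b; case: (eqVneq b 0) => [-> | /eqP b0].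
  by rewrite !mcompm0 (linear_0E (lin l)).
have ll' := irr_inj (schur_iso abA (irr_simple l) (irr_simple l') b0).
subst l'; have [a ->] := schur_scalar b abA (irr_simple l).
by rewrite !mcompZr !mcompm1 (linear_scale (lin l)).
Qed.

(** On a decomposition of [Z] the map has to be [g] of the injections followed by
    the projections; [irr_natural] shows that this works for every [alpha]. *)
Lemma irr_lift (Z X : A) (g : forall l, mor (I l) Z -> mor (I l) X) :
  (forall l, linear (g l)) ->
  exists f : mor Z X, forall l (alpha : mor (I l) Z), f \oc alpha = g l alpha.
Proof.
move=> lin; have [n [k [i [p [_ _ sip]]]]] := irr_decomposition Z.
exists (\sum_j g (k j) (i j) \oc p j) => l alpha.
rewrite -{2}(mcomp1m alpha) -sip !mcomp_suml (linear_sumE (lin l)).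
by apply: eq_bigr => j _; rewrite -!mcompA (irr_natural lin).
Qed.

(** Some projection of a decomposition of [S] does not kill [alpha]; by Schur's
    lemma their composite is invertible, which gives a retraction of [alpha]. *)
Lemma irr_summand (S : A) l (alpha : mor (I l) S) :
  alpha <> 0 -> direct_summand (I l) S.
Proof.
move=> a0; have [n [k [i [p [_ _ sip]]]]] := irr_decomposition S.
have [j pj] : exists j, p j \oc alpha <> 0.
  apply: contra_notP a0 => nex; rewrite -(mcomp1m alpha) -sip mcomp_suml.
  apply: big1 => j _; rewrite -mcompA.
  suff -> : p j \oc alpha = 0 by rewrite mcompm0.
  by apply: contrapT => pj; apply: nex; exists j.
have [r [rp _]] := schur_iso abA (irr_simple l) (irr_simple (k j)) pj.
by apply: (split_mono_summand abA (i := alpha) (r := r \oc p j)); rewrite -mcompA.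
Qed.

End SimpleCoordinates.

(** * The unfolding functor is an equivalence *)

Lemma ebas_ext (K : fieldType) (U V : vectType K) (f g : U -> V) :
  linear f -> linear g -> (forall k, f (ebas k) = g (ebas k)) -> f =1 g.
Proof.
move=> lf lg e u; rewrite (ebas_sum u) (lin_sum lf) (lin_sum lg).
by apply: eq_bigr => k _; rewrite e.
Qed.

Lemma ecoord_ebas (K : fieldType) (U : vectType K) (k k' : 'I_(\dim {:U})) :
  ecoord k (ebas k') = (k' == k)%:R.
Proof.
rewrite /ecoord lfunE_lin; last exact: linearP.
by rewrite coord_free ?(basis_free (vbasisP _)) // eq_sym.
Qed.

Section Unfolding.
Variables (K : closedFieldType) (C : fusionCat K) (M : leftModule C).
Hypothesis ssM : is_semisimple M.
Variables (Q : fusionQuiver C) (I : irr M).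
Notation act1 B f := (bmor (act M) (idm B) f).
Notation UQ := (unfolded Q I).
Notation RV := (Rep (VectModule K) UQ).
Notation F := (F_functor Q I).

(** [space], [space_map] present the objects and maps of the category of vector
    spaces as plain vector spaces and linear maps, with the two coordinates of a
    vertex of the unfolded quiver separated. *)
Definition space (W : RV) v l : vectType K := rep_obj W (v, l).

Definition space_map (W W' : RV) (h : mor W W') v l :
  'Hom(space W v l, space W' v l) := rep_comp h (v, l).

Lemma F_space_map (X Y : Rep M Q) (f : mor X Y) v l (beta : mor (I l) (rep_obj X v)) :
  space_map (fmor F f) v l beta = rep_comp f v \oc beta.
Proof.
by rewrite /space_map rep_compE /F_comp (lfunE_lin (@mcomp_linr _ _ _ _ _ _)).
Qed.

(** A representation of the unfolded quiver acts along every triple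
    [(e, l, l')], by zero when there is no edge.  This removes the subtype of
    edges from all later statements. *)
Definition edge_action (W : RV) e l l'
    (alpha : mor (I l') (act M (qlab e) (I l))) (w : space W (qsrc e) l) :
    space W (qtgt e) l' :=
  match pselect (direct_summand (I l') (act M (qlab e) (I l))) with
  | left ds => (rep_map W (exist _ (e, l, l') (asboolT ds)) : 'Hom(_, _)) (pure alpha w)
  | right _ => 0
  end.

Lemma edge_actionE (W : RV) (x : qedge UQ)
    (alpha : mor (I (val x).2) (act M (qlab (val x).1.1) (I (val x).1.2)))
    (w : space W (qsrc (val x).1.1) (val x).1.2) :
  edge_action alpha w = (rep_map W x : 'Hom(_, _)) (pure alpha w).
Proof.
case: x alpha w => -[[e l] l'] xP /= alpha w; rewrite /edge_action.
case: pselect => [ds | nds]; last by case: nds; apply/asboolP.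
by rewrite (bool_irrelevance (asboolT ds) xP).
Qed.

Lemma edge_action_bilinear (W : RV) e l l' : bilinear2 (@edge_action W e l l').
Proof.
by split=> [w | alpha] a x y; rewrite /edge_action; case: pselect => ?;
  rewrite ?pure_linl ?pure_linr ?linearP // scaler0 addr0.
Qed.

(** The formula defining [F] on edges also holds for the missing edges: there
    [alpha] is zero. *)
Lemma edge_action_F (X : Rep M Q) e l l'
    (alpha : mor (I l') (act M (qlab e) (I l)))
    (beta : mor (I l) (rep_obj X (qsrc e))) :
  @edge_action (F X) e l l' alpha beta =
  rep_map X e \oc act1 (qlab e) beta \oc alpha.
Proof.
rewrite /edge_action; case: pselect => [ds | nds].
  rewrite /= tliftE //; split=> w a g h; first by rewrite mcomp_linr.
  by rewrite bmor_linr mcomp_linr mcomp_linl.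
have -> : alpha = 0.
  by apply: contrapT => /(irr_summand (lm_abelian M) ssM).
by rewrite mcompm0.
Qed.

Lemma edge_action_hom (W W' : RV) (h : mor W W') e l l'
    (alpha : mor (I l') (act M (qlab e) (I l))) (w : space W (qsrc e) l) :
  space_map h (qtgt e) l' (edge_action alpha w) =
  edge_action alpha (space_map h (qsrc e) l w).
Proof.
rewrite /edge_action; case: pselect => [ds | nds]; last exact: linear0.
have := rep_homP h (exist _ (e, l, l') (asboolT ds)).
by move=> /lfunP/(_ (pure alpha w)); rewrite /= !comp_lfunE tmapE id_lfunE.
Qed.

Lemma edge_action_rep_hom (W W' : RV)
    (f : forall v l, 'Hom(space W v l, space W' v l)) :
  (forall e l l' (alpha : mor (I l') (act M (qlab e) (I l))) w,
     f (qtgt e) l' (edge_action alpha w) = edge_action alpha (f (qsrc e) l w)) ->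
  exists h : mor W W', forall v l, space_map h v l = f v l.
Proof.
move=> fe; pose f' (v : qvert UQ) : mor (rep_obj W v) (rep_obj W' v) :=
  let: (v0, l) := v in f v0 l.
have [|h hE] := @rep_hom_exists _ _ _ _ W W' f'; last first.
  by exists h => v l; rewrite /space_map hE.
move=> x; apply: tens_ext => alpha w; rewrite /= !comp_lfunE tmapE id_lfunE.
by rewrite -!edge_actionE; apply: fe.
Qed.

(** The identity of [act M B Z] is a sum of maps through the objects
    [act M B (I l)], and [irr_ext] tests equality on each of these. *)
Lemma act_irr_ext (B : C) (Z T : M) (f g : mor (act M B Z) T) :
  (forall l l' (alpha : mor (I l') (act M B (I l))) (beta : mor (I l) Z),
     f \oc act1 B beta \oc alpha = g \oc act1 B beta \oc alpha) -> f = g.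
Proof.
move=> e; have [n [l [i [p [_ _ sip]]]]] := irr_decomposition ssM I Z.
rewrite -(mcompm1 f) -(mcompm1 g) -bmor1 -sip (linear_sumE (bmor_linr _ _)).
rewrite !mcomp_sumr; apply: eq_bigr => j _.
rewrite act1M !mcompA; congr (_ \oc _).
by apply: (irr_ext (I := I) ssM) => l' alpha; apply: e.
Qed.

Lemma F_faithful (X Y : Rep M Q) (f g : mor X Y) : fmor F f = fmor F g -> f = g.
Proof.
move=> e; apply: rep_compP => v; apply: (irr_ext (I := I) ssM) => l beta.
by rewrite -!F_space_map e.
Qed.

Lemma F_full (X Y : Rep M Q) (h : mor (F X) (F Y)) : exists f, fmor F f = h.
Proof.
have lift v : {f : mor (rep_obj X v) (rep_obj Y v) |
    forall l (beta : mor (I l) (rep_obj X v)), f \oc beta = space_map h v l beta}.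
  apply: cid; have lin l : linear (space_map h v l) by exact: linearP.
  exact: (@irr_lift K M (lm_abelian M) ssM I (rep_obj X v) (rep_obj Y v)
    (fun l => space_map h v l) lin).
have [|f fE] := @rep_hom_exists _ _ _ _ X Y (fun v => sval (lift v)).
  move=> e; apply: act_irr_ext => l l' alpha beta.
  rewrite -!mcompA (svalP (lift _)) mcompA -edge_action_F edge_action_hom.
  by rewrite edge_action_F !mcompA -!(mcompA (rep_map Y e)) -act1M (svalP (lift _)).
exists f; apply: rep_compP => -[v l]; apply/lfunP=> beta.
have := F_space_map f (v := v) beta; rewrite fE (svalP (lift v)); exact.
Qed.

Section FoldedObject.
Variable W : RV.

(** One index for each basis vector of each [space W v l]. *)
Definition copies v : finType := {l : irr_index I & 'I_(\dim {: space W v l})}.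

Lemma copies_sum v : exists (S : M) (i : forall j : copies v, mor (I (tag j)) S)
  (p : forall j : copies v, mor S (I (tag j))), is_direct_sum i p.
Proof. exact: (direct_sum_exists (lm_abelian M) (fun j : copies v => I (tag j))). Qed.

Definition fold_space v : M := sval (cid (copies_sum v)).

Lemma fold_space_inj v : {i : forall j : copies v, mor (I (tag j)) (fold_space v) |
  exists p, is_direct_sum i p}.
Proof. exact: cid (svalP (cid (copies_sum v))). Qed.

Definition fold_inj v := sval (fold_space_inj v).
Definition fold_proj v := sval (cid (svalP (fold_space_inj v))).

Lemma inj_proj v : is_direct_sum (@fold_inj v) (@fold_proj v).
Proof. exact: svalP (cid (svalP (fold_space_inj v))). Qed.

Definition copy v l (k : 'I_(\dim {: space W v l})) : copies v :=
  Tagged (fun l => 'I_(\dim {: space W v l})) k.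

(** [copy_inj], [copy_proj] have [I l] in their types where [fold_inj],
    [fold_proj] have [I (tag (copy k))], which rewriting does not identify. *)
Definition copy_inj v l (k : 'I_(\dim {: space W v l})) : mor (I l) (fold_space v) :=
  fold_inj (copy k).

Definition copy_proj v l (k : 'I_(\dim {: space W v l})) : mor (fold_space v) (I l) :=
  fold_proj (copy k).

Lemma copy_injK v l (k : 'I_(\dim {: space W v l})) :
  copy_proj k \oc copy_inj k = idm (I l).
Proof. by have [pii _ _] := inj_proj v; exact: (pii (copy k)). Qed.

Lemma proj_copy_inj v l (k : 'I_(\dim {: space W v l})) (j : copies v) :
  j != copy k -> fold_proj j \oc copy_inj k = 0.
Proof.
move=> jk; have [_ pil _] := inj_proj v; apply: (pil (copy k) j) => e.
by rewrite e eqxx in jk.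
Qed.

(** The basis vector [ebas k] goes to the injection of the [k]-th copy of
    [I l]; this identifies [W] with the image of its folding under [F]. *)
Definition fold_coord v l : 'Hom(space W v l, mor (I l) (fold_space v)) :=
  linfun (fun w : space W v l => \sum_k (ecoord k w : K) *: copy_inj k).

Lemma fold_coordE v l w : fold_coord v l w =
  \sum_k (ecoord k w : K) *: copy_inj k.
Proof.
rewrite /fold_coord lfunE_lin // => a x y; rewrite scaler_sumr -big_split.
by apply: eq_bigr => k _; rewrite linearP scalerDl scalerA.
Qed.

Lemma fold_coord_ebas v l k : fold_coord v l (ebas k) = copy_inj k.
Proof.
rewrite fold_coordE (bigD1 k) //= ecoord_ebas eqxx scale1r big1 ?addr0 // => k' k'k.
by rewrite ecoord_ebas eq_sym (negPf k'k) scale0r.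
Qed.

(** Injectivity comes from composing with the projections.  For surjectivity,
    [alpha] is the sum over the copies of its components, and by Schur's lemma
    only copies of [I l] itself contribute, each by a scalar. *)
Lemma fold_coord_iso v l :
  @is_iso K (VectCat K) (space W v l) (mor (I l) (fold_space v)) (fold_coord v l).
Proof.
have [_ _ sip] := inj_proj v.
apply: vect_isoP.
- rewrite -subv0; apply/subvP=> w; rewrite memv_ker fold_coordE memv0 => /eqP w0.
  rewrite (ebas_sum w) big1 // => k _.
  suff -> : (ecoord k w : K) = 0 by rewrite scale0r.
  have := congr1 (fun f => copy_proj k \oc f) w0.
  rewrite mcompm0 mcomp_sumr (bigD1 k) //= mcompZr copy_injK big1 => [|k' k'k].
    rewrite addr0 => /eqP; rewrite scaler_eq0 => /orP[/eqP // | /eqP id0].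
    by case: (irr_simple l).1; apply: is_zero_idm.
  have kk' : copy k != copy k' by rewrite eq_Tagged eq_sym.
  rewrite mcompZr; have -> : copy_proj k \oc copy_inj k' = 0 := proj_copy_inj kk'.
  exact: scaler0.
- apply/eqP; rewrite eqEsubv subvf; apply/subvP=> alpha _ /=.
  rewrite -(mcomp1m alpha) -sip mcomp_suml; apply: memv_suml => -[l' k] _.
  rewrite -mcompA; move: (_ \oc alpha) => /= b.
  have [-> | /eqP b0] := eqVneq b 0; first by rewrite mcompm0 mem0v.
  have ll' := irr_inj (schur_iso (lm_abelian M) (irr_simple l) (irr_simple l') b0).
  move: b {b0}; move: ll' k => /= <- k b.
  have [a ->] := schur_scalar b (lm_abelian M) (irr_simple l).
  rewrite mcompZr mcompm1 memvZ // -[fold_inj _]/(copy_inj k) -fold_coord_ebas.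
  by rewrite memv_img ?memvf.
Qed.

(** What composition with the structure map of the folded representation must
    do, read off by expanding [gamma] along the decomposition of
    [fold_space (qsrc e)]. *)
Definition fold_action e l'
    (gamma : mor (I l') (act M (qlab e) (fold_space (qsrc e)))) :
    mor (I l') (fold_space (qtgt e)) :=
  fold_coord (qtgt e) l'
    (\sum_(j : copies (qsrc e))
      edge_action (act1 (qlab e) (fold_proj j) \oc gamma) (ebas (tagged j))).

Lemma fold_action_lin e l' : linear (@fold_action e l').
Proof.
move=> a x y; rewrite /fold_action -linearP scaler_sumr -big_split.
congr (fold_coord _ _ _); apply: eq_bigr => j _.
by rewrite mcomp_linr (edge_action_bilinear W _ _ _).1.
Qed.

(** By linearity [w] may be taken to be a basis vector, and then a single term
    of the sum defining [fold_action] survives. *)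
Lemma fold_action_coord e l l' (alpha : mor (I l') (act M (qlab e) (I l))) w :
  fold_action (act1 (qlab e) (fold_coord (qsrc e) l w) \oc alpha) =
  fold_coord (qtgt e) l' (edge_action alpha w).
Proof.
move: w; apply: ebas_ext => [a x y | a x y | k].
- by rewrite linearP bmor_linr mcomp_linl fold_action_lin.
- by rewrite (edge_action_bilinear W _ _ _).2 linearP.
rewrite fold_coord_ebas /fold_action (bigD1 (copy k)) //= big1 => [|j jk].
  rewrite addr0 -[fold_proj _]/(copy_proj k).
  have e1 : act1 (qlab e) (copy_proj k)
      \oc (act1 (qlab e) (copy_inj k) \oc alpha) = alpha.
    by rewrite mcompA -act1M copy_injK bmor1 mcomp1m.
  by congr (fold_coord _ _ _); exact: (congr1 (fun z => edge_action z (ebas k)) e1).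
rewrite mcompA -act1M proj_copy_inj //.
rewrite (linear_0E (bmor_linr _ _)) mcomp0m.
exact: (linear_0E ((edge_action_bilinear W _ _ _).1 _)).
Qed.

Lemma F_essentially_surjective : exists (X : Rep M Q) (f : mor W (F X)), is_iso f.
Proof.
have lift e : {phi : mor (act M (qlab e) (fold_space (qsrc e))) (fold_space (qtgt e)) |
    forall l' gamma, phi \oc gamma = @fold_action e l' gamma}.
  apply: cid; exact: (irr_lift (lm_abelian M) ssM (@fold_action_lin e)).
pose X : Rep M Q := MkRep fold_space (fun e => sval (lift e)).
have [|f fE] := @edge_action_rep_hom W (F X) fold_coord.
  move=> e l l' alpha w.
  by rewrite edge_action_F -mcompA (svalP (lift e)) fold_action_coord.
exists X, f; apply: rep_isoP => -[v l]; have := fE v l; rewrite /space_map => ->.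
exact: fold_coord_iso.
Qed.

End FoldedObject.

Theorem F_equivalence : is_equivalence F.
Proof.
apply: fully_faithful_equivalence; [exact: F_faithful | exact: F_full |].
move=> W; have [X [f /is_iso_inverse[g isog]]] := F_essentially_surjective W.
by exists X, g.
Qed.

End Unfolding.

Theorem theorem3p12 (K : closedFieldType) (C : fusionCat K)
    (Q : fusionQuiver C) (M : bimodule C (Vect K))
    (finM : is_finite M) (ssM : is_semisimple M) (I : irr M) :
  is_abelian (Rep M Q) /\
  is_abelian (Rep (VectModule K) (unfolded Q I)) /\
  is_equivalence (F_functor Q I).
Proof.
split; first exact: rep_abelian.
split; first exact: rep_abelian.
exact: F_equivalence.
Qed.
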